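(* Consider the vehicle-service model and the NRPS policy described in the context, with control parameters $\rho\in(0,\infty)$ and $\eta\in(0,\tfrac12)$. There exists a function $\Phi_1(\rho,\eta)$ (not depending on $d$) such that (i) $\Phi_1(\rho,\eta)$ is finite and positive for all $\rho\in(0,\infty)$ and $\eta\in(0,\tfrac12)$; and (ii) for all $d\ge 5$ and all links $(i,j)$, $i\neq j$, $$\mathbb{E}\left\{\|\hat{\boldsymbol\theta}_{ij}^{d-1}-\boldsymbol\theta_{ij}\|_2^2\right\}<\Phi_1(\rho,\eta)\,\frac{\ln(d-1)}{(d-1)^{1-2\eta}}.$$ Consequently, for all links $(i,j)$, $\mathbb{E}\{\|\hat{\boldsymbol\theta}_{ij}^{d-1}-\boldsymbol\theta_{ij}\|_2^2\}\to 0$ as $d\to\infty$. (The expectation is over the demand shocks and the randomness of the policy.)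
   Context: Model. There are locations $\mathcal N=\{1,\dots,N\}$ and days $d=1,\dots,D$. For each ordered pair (link) $(i,j)$, $i\neq j$, there are unknown parameters $\boldsymbol\theta_{ij}=(\alpha_{ij},\beta_{ij})$ with $0<\alpha_{\min}\le\alpha_{ij}\le\alpha_{\max}$ and $0<\beta_{\min}\le\beta_{ij}\le\beta_{\max}$ (only the bounds $\alpha_{\min},\alpha_{\max},\beta_{\min},\beta_{\max}$ are known to the provider), a travel time $\xi_{ij}>0$, and demand shocks $\epsilon_{ij}^d\in[\underline\epsilon,\overline\epsilon]$; for each link, $\{\epsilon_{ij}^d\}_{d=1,\dots,D}$ are i.i.d. with known c.d.f. $F_{ij}$ and $\mathbb{E}\{\epsilon_{ij}^d\}=0$. There is a maximum price $p_{\max}$ and a per-slot vehicle cost $c$ with $0<c<p_{\max}$, and it is assumed that $\alpha_{\min}-\beta_{\max}p_{\max}+\underline\epsilon\ge 0$. On day $d$ the provider chooses prices $p_{ij}^d\le p_{\max}$ and supplies $w_{ij}^d\ge0$ satisfying flow balance $\sum_{j\neq i}w_{ij}^d=\sum_{j\neq i}w_{ji}^d$ for all $i$; the realized demand $\Psi_{ij}^d=\alpha_{ij}-\beta_{ij}p_{ij}^d+\epsilon_{ij}^d$ is then observed for every link. Least-squares estimate. For $t\ge1$ and each link, let $\tilde{\boldsymbol\theta}_{ij}^{t}=(\tilde\alpha_{ij}^t,\tilde\beta_{ij}^t)$ minimize over $(\bar\alpha,\bar\beta)\in\mathbb R^2$ the quantity $\sum_{\tau=1}^{t}\big(\Psi_{ij}^\tau-(\bar\alpha-\bar\beta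 p_{ij}^\tau)\big)^2$, and let $\hat{\boldsymbol\theta}_{ij}^{t}=(\hat\alpha_{ij}^t,\hat\beta_{ij}^t)$ with $\hat\alpha_{ij}^t=\max\{\min\{\tilde\alpha_{ij}^t,\alpha_{\max}\},\alpha_{\min}\}$ and $\hat\beta_{ij}^t=\max\{\min\{\tilde\beta_{ij}^t,\beta_{\max}\},\beta_{\min}\}$. $\hat{\boldsymbol\theta}^{t}$ denotes the vector over all links. Estimated optimization problem. For an estimate $\hat{\boldsymbol\theta}=(\hat\alpha_{ij},\hat\beta_{ij})_{i\neq j}$, let $(\mathbf p^*(\hat{\boldsymbol\theta}),\mathbf w^*(\hat{\boldsymbol\theta}))$ denote an optimal solution of: maximize $\sum_{i}\sum_{j\neq i}\xi_{ij}\,\mathbb{E}_{\epsilon_{ij}}\{\min\{\hat\alpha_{ij}-\hat\beta_{ij}p_{ij}+\epsilon_{ij},w_{ij}\}\}\,p_{ij}-\sum_i\sum_{j\neq i}\xi_{ij}w_{ij}c$ subject to $\sum_{j\neq i}w_{ij}=\sum_{j\neq i}w_{ji}$ for all $i$, $w_{ij}=\hat\alpha_{ij}-\hat\beta_{ij}p_{ij}$, $p_{ij}\le p_{\max}$, $w_{ij}\ge0$ for all links. NRPS policy. Initialization: for each link, $\hat{\boldsymbol\theta}_{ij}^0$ is drawn from $[\alpha_{\min},\alpha_{\max}]\times[\beta_{\min},\beta_{\max}]$ according to an arbitrary distribution; choose $\rho\in(0,\infty)$, $\eta\in(0,\frac12)$. On each odd day $d$: compute $\hat{\boldsymbol\theta}^{d-1}$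 (the least-squares estimate above for $d\ge3$; the initial draw for $d=1$) and implement $p_{ij}^d=p_{ij}^*(\hat{\boldsymbol\theta}^{d-1})$, $w_{ij}^d=w_{ij}^*(\hat{\boldsymbol\theta}^{d-1})$. On each even day $d$: implement $p_{ij}^d=p_{ij}^*(\hat{\boldsymbol\theta}^{d-2})-\frac{\rho}{\hat\beta_{ij}^{d-2}}d^{-\eta}$ and $w_{ij}^d=w_{ij}^*(\hat{\boldsymbol\theta}^{d-2})+\rho d^{-\eta}$. *)

(* Defs.v *)
From HB Require Import structures.
From mathcomp Require Import all_boot all_order all_algebra.
From mathcomp Require Import all_classical all_reals all_analysis.
Set Implicit Arguments. Unset Strict Implicit. Unset Printing Implicit Defensive.
Import Order.TTheory GRing.Theory Num.Theory.
Local Open Scope classical_set_scope.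
Local Open Scope ring_scope.

(* Locations are 'I_N; a link is an ordered pair (i,j) with i != j.
   Link-indexed quantities are functions 'I_N -> 'I_N -> R; their
   diagonal values are irrelevant. *)

Section Defs.
Variables (R : realType) (N : nat).
Variables (dm : measure_display) (Omega : measurableType dm)
          (P : probability Omega R).

Definition clamp (lo hi x : R) : R := Num.max (Num.min x hi) lo.

Definition demand (alpha beta : 'I_N -> 'I_N -> R)
  (price : nat -> 'I_N -> 'I_N -> Omega -> R)
  (eps : 'I_N -> 'I_N -> nat -> Omega -> R)
  (d : nat) (i j : 'I_N) (w : Omega) : R :=
  alpha i j - beta i j * price d i j w + eps i j d w.

Definition lsq_obj (alpha beta : 'I_N -> 'I_N -> R)
  (price : nat -> 'I_N -> 'I_N -> Omega -> R)
  (eps : 'I_N -> 'I_N -> nat -> Omega -> R)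
  (t : nat) (i j : 'I_N) (w : Omega) (a b : R) : R :=
  \sum_(1 <= tau < t.+1)
     (demand alpha beta price eps tau i j w - (a - b * price tau i j w)) ^+ 2.

Definition feasible (ah bh : 'I_N -> 'I_N -> R) (pmax : R)
  (p w : 'I_N -> 'I_N -> R) : Prop :=
  (forall i : 'I_N, \sum_(j < N | j != i) w i j = \sum_(j < N | j != i) w j i) /\
  (forall i j : 'I_N, i != j ->
     [/\ w i j = ah i j - bh i j * p i j, p i j <= pmax & 0 <= w i j]).

(* objective of the estimated problem; the expectation over eps_ij (whose
   c.d.f. is F_ij) is taken as the expectation of the day-1 shock eps_ij^1,
   which has law F_ij. *)
Definition objective (eps : 'I_N -> 'I_N -> nat -> Omega -> R)
  (xi : 'I_N -> 'I_N -> R) (c : R) (ah bh : 'I_N -> 'I_N -> R)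
  (p w : 'I_N -> 'I_N -> R) : R :=
  \sum_(i < N) \sum_(j < N | j != i)
    (xi i j * fine ('E_P[fun om => Num.min (ah i j - bh i j * p i j + eps i j 1%N om)
                                           (w i j)]) * p i j
     - xi i j * w i j * c).

Definition is_optimal (eps : 'I_N -> 'I_N -> nat -> Omega -> R)
  (xi : 'I_N -> 'I_N -> R) (c pmax : R) (ah bh : 'I_N -> 'I_N -> R)
  (p w : 'I_N -> 'I_N -> R) : Prop :=
  feasible ah bh pmax p w /\
  forall p' w', feasible ah bh pmax p' w' ->
    objective eps xi c ah bh p' w' <= objective eps xi c ah bh p w.

Definition past_events (a0 b0 : 'I_N -> 'I_N -> Omega -> R)
  (eps : 'I_N -> 'I_N -> nat -> Omega -> R) (d : nat) : set (set Omega) :=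
  <<s [set E | exists (i j : 'I_N) (B : set R), i != j /\ measurable B /\
        (E = a0 i j @^-1` B \/ E = b0 i j @^-1` B \/
         exists tau, (1 <= tau < d)%N /\ E = eps i j tau @^-1` B)] >>.

Definition shock_indep_past (a0 b0 : 'I_N -> 'I_N -> Omega -> R)
  (eps : 'I_N -> 'I_N -> nat -> Omega -> R) : Prop :=
  forall d : nat, (1 <= d)%N ->
  forall B : 'I_N -> 'I_N -> set R, (forall i j, measurable (B i j)) ->
  forall E, past_events a0 b0 eps d E ->
    let S := \bigcap_(k in [set k : 'I_N * 'I_N | k.1 != k.2])
               (eps k.1 k.2 d @^-1` B k.1 k.2) in
    (P (E `&` S) = P E * P S)%E.

End Defs.

(* Main.v *)
(* Fix a link and write [V_t] for the Gram matrix of the regressors [(1, p_k)],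
   [k <= t], and [xi_t] for the sum of [(1, p_k) eps_k].  By Sherman-Morrison
   the form [Q_t = xi_t^T V_t^-1 xi_t] satisfies
     [Q_(t+1) <= Q_t + 2 eps_(t+1) L_t + eps_(t+1)^2 (1 - det V_t / det V_(t+1))]
   with [L_t] a function of the past.  The second term has mean zero, and since
   [1 - x <= - ln x] the last one telescopes, so [E Q_t = O(ln det V_t) = O(ln t)].
   The prices of days [2k-1] and [2k] differ by at least
   [(rho / bmax) (2k)^(-eta)], which bounds [det V_t] below by a multiple of
   [t * t^(1 - 2 eta)], and [|V_t^-1 xi_t|^2 <= tr V_t / det V_t * Q_t].

   That [L_t] is measurable with respect to the past is not immediate, because
   the selection [popt] is arbitrary and may read the uncontrolled diagonal of
   the estimates.  The estimated problem is strongly concave, so its optimum is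
   unique and Hoelder continuous in the off-diagonal estimates. *)

Require Import Defs.
From HB Require Import structures.
From mathcomp Require Import all_boot all_order all_algebra.
From mathcomp Require Import all_classical all_reals all_analysis.
From mathcomp Require Import measurable_realfun ring lra.
Import Order.TTheory GRing.Theory Num.Theory numFieldNormedType.Exports.
Local Open Scope classical_set_scope.
Local Open Scope ring_scope.

(** * Least squares along one price path *)

(** Prices are capped from above but not from below, and supplies are not capped at all. The uniform
    price bound behind [det V_t = O(t^2)] and [tr V_t = O(t)] therefore has to come from the
    objective, which decreases quadratically in the supply and so bounds every optimal supply
    uniformly over the box of estimates. A shock is independent only of events of its past, so
    measurability of the prices on [Omega] does not make [eps_(t+1) L_t] centred. The prices are
    shown measurable a second time, on [Omega] equipped with the sigma-algebra generated by the
    initial draw and the earlier shocks. The factor [tr V_t / det V_t] is random. It is replaced by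
    a deterministic bound along each path, before any expectation is taken, so that the centred
    terms are merely rescaled. Clamping does no harm: the true parameter lies in the box, and
    projecting onto an interval brings a point no farther from the points of that interval. *)

Definition psum {R : realType} (u : nat -> R) (t : nat) : R :=
  \sum_(1 <= k < t.+1) u k.

Lemma psumS (R : realType) (u : nat -> R) (t : nat) :
  psum u t.+1 = psum u t + u t.+1.
Proof. by rewrite /psum big_nat_recr. Qed.

Lemma psum0 (R : realType) (u : nat -> R) : psum u 0 = 0.
Proof. by rewrite /psum big_nil. Qed.

(* For regressors [(1, p k)], [k <= t], and responses [e k]: the determinant of
   the Gram matrix [V], and the quadratic form [xi^T V^-1 xi] at
   [xi = \sum_k (1, p k) e k]. *)
Definition gram_det {R : realType} (p : nat -> R) (t : nat) : R :=
  t%:R * psum (fun k => p k ^+ 2) t - psum p t ^+ 2.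

Definition gram_quad {R : realType} (p e : nat -> R) (t : nat) : R :=
  (psum (fun k => p k ^+ 2) t * psum e t ^+ 2
   - 2 * psum p t * psum e t * psum (fun k => p k * e k) t
   + t%:R * psum (fun k => p k * e k) t ^+ 2) / gram_det p t.

(** This is the [L_t] of the overview. With [x = (1, p t.+1)] it is
    [x^T adj(V_t) xi_t / det V_(t+1)], that is [x^T V_(t+1)^-1 xi_t]. It reads prices up to day
    [t.+1] but shocks only up to day [t]. *)
Definition gram_incr {R : realType} (p e : nat -> R) (t : nat) : R :=
  ((psum (fun k => p k ^+ 2) t - p t.+1 * psum p t) * psum e t
   + (t%:R * p t.+1 - psum p t) * psum (fun k => p k * e k) t)
  / gram_det p t.+1.

Lemma gram_detS (R : realType) (p : nat -> R) (t : nat) :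
  gram_det p t.+1 = gram_det p t
    + (psum (fun k => p k ^+ 2) t - 2 * psum p t * p t.+1 + t%:R * p t.+1 ^+ 2).
Proof. by rewrite /gram_det !psumS -natr1; ring. Qed.

(** Multiplied by [t], the increment [x^T adj(V_t) x] is a square plus [gram_det p t] itself, whence
    the sign hypothesis. *)
Lemma gram_det_le (R : realType) (p : nat -> R) (t : nat) :
  (0 < t)%N -> 0 <= gram_det p t -> gram_det p t <= gram_det p t.+1.
Proof.
move=> t0 D0; rewrite gram_detS lerDl.
have t0R : 0 < t%:R :> R by rewrite ltr0n.
rewrite -(pmulr_rge0 _ t0R).
set q := psum _ t; set s := psum p t.
have -> : t%:R * (q - 2 * s * p t.+1 + t%:R * p t.+1 ^+ 2)
  = (t%:R * p t.+1 - s) ^+ 2 + gram_det p t by rewrite /gram_det -/q -/s; ring.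
by rewrite addr_ge0 // sqr_ge0.
Qed.

(* Sherman-Morrison. *)
Lemma gram_quadS (R : realType) (p e : nat -> R) (t : nat) :
  gram_det p t != 0 -> gram_det p t.+1 != 0 ->
  gram_quad p e t.+1 = gram_quad p e t
    - gram_incr p e t ^+ 2 * gram_det p t.+1 / gram_det p t
    + 2 * (e t.+1 * gram_incr p e t)
    + e t.+1 ^+ 2 * (1 - gram_det p t / gram_det p t.+1).
Proof.
rewrite /gram_quad /gram_incr /gram_det !psumS -natr1.
set q := psum _ t; set s := psum p t; set g := psum e t.
set h := psum _ t; set x := p _; set y := e _ => D0 D1.
by field; rewrite D0 D1.
Qed.

Lemma ln_sub_ge (R : realType) (x y : R) : 0 < x -> 0 < y ->
  1 - x / y <= ln y - ln x.
Proof.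
move=> x0 y0; have xy : 0 < x / y by rewrite divr_gt0.
have := le_ln1Dx (x := x / y - 1).
rewrite addrCA subrr addr0 => /(_ _).
rewrite ltrBrDr addrC subrr => /(_ xy).
by rewrite ln_div ?posrE//; lra.
Qed.

(** Sums [gram_quadS] from [t = 2], the first time at which [V] can be invertible. The negative
    square is dropped; the terms linear in the new shock are kept exactly, because it is their mean
    that vanishes and not their size. *)
Lemma gram_quad_bound (R : realType) (p e : nat -> R) (B : R) (t : nat) :
  (forall k, (1 <= k)%N -> `|e k| <= B) ->
  (forall k, (2 <= k)%N -> 0 < gram_det p k) -> (2 <= t)%N ->
  gram_quad p e t <= 2 * B ^+ 2 + 2 * \sum_(2 <= k < t) e k.+1 * gram_incr p e k
    + B ^+ 2 * (ln (gram_det p t) - ln (gram_det p 2)).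
Proof.
move=> eB D0.
have e2 k : (1 <= k)%N -> e k ^+ 2 <= B ^+ 2.
  by move=> k1; rewrite -real_normK ?num_real// lerXn2r ?nnegrE// ?eB//
    (le_trans _ (eB k k1)).
elim: t => // t IH; rewrite leq_eqVlt => /orP[/eqP <-|].
  rewrite big_geq// mulr0 subrr mulr0 !addr0.
  have := D0 2%N erefl; rewrite /gram_quad /gram_det.
  rewrite !psumS !psum0 !add0r => /lt0r_neq0 D2.
  (* Two observations at distinct prices are interpolated exactly, so at time 2 the form is the full
     sum of squared responses. *)
  have -> : forall x y a b : R, 2%:R * (a ^+ 2 + b ^+ 2) - (a + b) ^+ 2 != 0 ->
    ((a ^+ 2 + b ^+ 2) * (x + y) ^+ 2 - 2 * (a + b) * (x + y) * (a * x + b * y) +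
   2%:R * (a * x + b * y) ^+ 2) / (2%:R * (a ^+ 2 + b ^+ 2) - (a + b) ^+ 2) = x ^+ 2 + y ^+ 2.
    by move=> x y a b h; field.
  - by rewrite mulr_natl mulr2n lerD// e2.
  - by [].
rewrite ltnS => t2; have {IH} := IH t2.
have Dt := D0 _ t2; have DS := D0 _ (leqW t2).
rewrite gram_quadS ?gt_eqF// big_nat_recr//= => IH.
set i2 := _ ^+ 2 * gram_det p t.+1 / _.
have i20 : 0 <= i2.
  by apply: divr_ge0 (ltW Dt); apply: mulr_ge0 (ltW DS); exact: sqr_ge0.
have g0 : 0 <= 1 - gram_det p t / gram_det p t.+1.
  by rewrite subr_ge0 ler_pdivrMr// mul1r gram_det_le// ?ltW// (ltn_trans _ t2).
have g1 := @ln_sub_ge _ _ _ Dt DS.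
have : e t.+1 ^+ 2 * (1 - gram_det p t / gram_det p t.+1) <=
       B ^+ 2 * (ln (gram_det p t.+1) - ln (gram_det p t)).
  by apply: ler_pM => //; rewrite ?sqr_ge0 ?e2.
lra.
Qed.

(** Days [2k-1] and [2k] are paired: whatever the centre [m], their squared deviations add up to at
    least half of the squared price difference. An unpaired last day can only add to the sum. *)
Lemma psum_sqr_dev_ge (R : realType) (p : nat -> R) (m dl : R) (t : nat) :
  (forall k, (1 <= k)%N -> (k.*2 <= t)%N -> dl <= (p k.*2.-1 - p k.*2) ^+ 2) ->
  dl / 2 * (t./2)%:R <= psum (fun k => (p k - m) ^+ 2) t.
Proof.
move=> pd.
have psle (u : nat -> R) a : (forall k, 0 <= u k) -> psum u a <= psum u a.+1.
  by move=> u0; rewrite psumS lerDl.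
have main k : (k.*2 <= t)%N -> dl / 2 * k%:R <= psum (fun k => (p k - m) ^+ 2) k.*2.
  elim: k => [|k IH] kt; first by rewrite psum0 mulr0.
  rewrite doubleS !psumS -[k.+1%:R]natr1 mulrDr -addrA lerD//.
    by apply: IH; rewrite (leq_trans _ kt)// leq_double.
  have := pd k.+1 erefl kt; rewrite doubleS /=.
  set x := p _; set y := p _ => h.
  have : 0 <= (x + y - 2 * m) ^+ 2 by rewrite sqr_ge0.
  by rewrite mulr1; nra.
rewrite -[X in psum _ X](odd_double_half t).
have h : ((t./2).*2 <= t)%N by rewrite -[leqRHS](odd_double_half t) leq_addl.
apply: le_trans (main _ h) _.
case: (odd t) => //=; rewrite add1n; apply: psle => k; exact: sqr_ge0.
Qed.

Lemma gram_det_dev (R : realType) (p : nat -> R) (t : nat) : (0 < t)%N ->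
  gram_det p t = t%:R * psum (fun k => (p k - psum p t / t%:R) ^+ 2) t.
Proof.
move=> t0; have t0R : t%:R != 0 :> R by rewrite pnatr_eq0 -lt0n.
have dev m u : psum (fun k => (p k - m) ^+ 2) u
    = psum (fun k => p k ^+ 2) u - 2 * m * psum p u + u%:R * m ^+ 2.
  elim: u => [|u IH]; first by rewrite !psum0; ring.
  by rewrite !psumS IH -natr1; ring.
by rewrite dev /gram_det; field.
Qed.

(** As [k^(-eta)] decreases, every pair up to day [t] has a gap of at least [kap * t^(-eta)]. The 6
    is the 2 of [psum_sqr_dev_ge] times the 3 of [t <= 3 * t./2], which is sharp at [t = 3]. *)
Lemma gram_det_ge (R : realType) (p : nat -> R) (kap eta : R) (t : nat) :
  0 < kap -> 0 < eta -> (2 <= t)%N ->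
  (forall k, (1 <= k)%N ->
     kap * k.*2%:R `^ (- eta) <= p k.*2.-1 - p k.*2) ->
  kap ^+ 2 / 6 * t%:R * t%:R `^ (1 - 2 * eta) <= gram_det p t.
Proof.
move=> kap0 eta0 t2 pd.
have t0 : (0 < t)%N by apply: ltn_trans t2.
have t0R : 0 < t%:R :> R by rewrite ltr0n.
rewrite gram_det_dev// mulrAC mulrC ler_pM2l//.
set m := psum p t / _.
have := @psum_sqr_dev_ge R p m ((kap * t%:R `^ (- eta)) ^+ 2) t.
move=> /(_ _)/(le_trans _); apply; last first.
  move=> k k1 kt; rewrite lerXn2r ?nnegrE ?mulr_ge0 ?powR_ge0 ?(ltW kap0)//.
    apply: le_trans (pd k k1); rewrite mulr_ge0 ?powR_ge0// ltW//.
  apply: le_trans (pd k k1); rewrite ler_pM2l// !powRN lef_pV2 ?posrE ?powR_gt0//.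
    by rewrite ge0_ler_powR ?nnegrE ?ler0n ?(ltW eta0)// ler_nat.
  by rewrite ltr0n double_gt0.
have h : t%:R <= 3 * (t./2)%:R :> R.
  rewrite -natrM ler_nat -[in leqLHS](odd_double_half t) -addnn.
  case: t t2 {t0 t0R pd m} => [|[|t]]// _; rewrite mulSn mulSn mul1n.
  by rewrite leq_add2r; case: (odd _) => //=; rewrite add1n.
have -> : t%:R `^ (1 - 2 * eta) = t%:R * (t%:R `^ (- eta)) ^+ 2.
  rewrite powRD; last by rewrite (gt_eqF t0R) implybT.
  rewrite powRr1// ?ler0n// -powR_mulrn ?powR_ge0// -powRrM.
  by rewrite mulNr [eta * _]mulrC.
rewrite exprMn.
set z := (_ `^ _) ^+ 2; have z0 : 0 <= z by apply: sqr_ge0.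
have : 0 <= kap ^+ 2 * z by rewrite mulr_ge0// sqr_ge0.
set K := kap ^+ 2 * z => K0.
have -> : kap ^+ 2 / 6 * (t%:R * z) = K / 6 * t%:R by rewrite /K; ring.
nra.
Qed.

(** First-order optimality without derivatives: the test point [- C / (|A| + 1)], chosen so that the
    sign of [A] does not matter, turns the expression into a negative multiple of [C ^+ 2]. *)
Lemma quadratic_ge0_lin (R : realType) (A C : R) :
  (forall x, 0 <= A * x ^+ 2 + 2 * C * x) -> C = 0.
Proof.
move=> h; apply/eqP; rewrite -sqrf_eq0 eq_le sqr_ge0 andbT.
have a1 : 0 < `|A| + 1 by rewrite ltr_wpDl.
have := h (- C / (`|A| + 1)).
have -> : A * (- C / (`|A| + 1)) ^+ 2 + 2 * C * (- C / (`|A| + 1))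
   = C ^+ 2 * (A - 2 * (`|A| + 1)) / (`|A| + 1) ^+ 2 by field; rewrite gt_eqF.
rewrite ler_pdivlMr ?exprn_gt0// mul0r.
have := ler_norm A; have := normr_ge0 A; have := sqr_ge0 C.
by set c := C ^+ 2; nra.
Qed.

(** Perturbing [u] and [v] separately yields the two normal equations, solved by Cramer's rule. The
    fitted line is [u - v * p], so [v] is minus the second coordinate of [V^-1 xi]. *)
Lemma lsq_normal (R : realType) (p e : nat -> R) (u v : R) (t : nat) :
  gram_det p t != 0 ->
  (forall a b, psum (fun k => (e k - (u - v * p k)) ^+ 2) t
            <= psum (fun k => (e k - (a - b * p k)) ^+ 2) t) ->
  u = (psum (fun k => p k ^+ 2) t * psum e t
       - psum p t * psum (fun k => p k * e k) t) / gram_det p t /\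
  v = (psum p t * psum e t
       - t%:R * psum (fun k => p k * e k) t) / gram_det p t.
Proof.
move=> D0 opt.
have dev a b n : psum (fun k => (e k - (a - b * p k)) ^+ 2) n
   = psum (fun k => e k ^+ 2) n + n%:R * a ^+ 2 + b ^+ 2 * psum (fun k => p k ^+ 2) n
     - 2 * a * psum e n + 2 * b * psum (fun k => p k * e k) n
     - 2 * a * b * psum p n.
  elim: n => [|n IH]; first by rewrite !psum0; ring.
  by rewrite !psumS IH -natr1; ring.
move: opt D0; rewrite /gram_det.
set q := psum (fun k => p k ^+ 2) t; set s := psum p t; set g := psum e t.
set h := psum (fun k => p k * e k) t.
set r := psum (fun k => e k ^+ 2) t => opt0 D0.
have opt a b : r + t%:R * u ^+ 2 + v ^+ 2 * q - 2 * u * g + 2 * v * h - 2 * u * v * s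
    <= r + t%:R * a ^+ 2 + b ^+ 2 * q - 2 * a * g + 2 * b * h - 2 * a * b * s.
  by have := opt0 a b; rewrite !dev.
have E1 : t%:R * u - s * v - g = 0.
  apply: (@quadratic_ge0_lin _ t%:R) => x.
  by have := opt (u + x) v; rewrite -subr_ge0; congr (_ <= _); ring.
have E2 : q * v - s * u + h = 0.
  apply: (@quadratic_ge0_lin _ q) => x.
  by have := opt u (v + x); rewrite -subr_ge0; congr (_ <= _); ring.
have Eg : g = t%:R * u - s * v by apply/eqP; rewrite eq_sym -subr_eq0 E1.
have Eh : h = s * u - q * v by apply/eqP; rewrite -subr_eq0 -E2; apply/eqP; ring.
by rewrite Eg Eh; split; field.
Qed.

(* Cayley-Hamilton, [V^2 - tr V *: V + det V = 0], gives
   [|u|^2 <= tr V / det V * u^T V u]. *)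
Lemma lsq_error_le (R : realType) (p e : nat -> R) (t : nat) :
  0 < gram_det p t ->
  ((psum (fun k => p k ^+ 2) t * psum e t
       - psum p t * psum (fun k => p k * e k) t) / gram_det p t) ^+ 2 +
  ((psum p t * psum e t
       - t%:R * psum (fun k => p k * e k) t) / gram_det p t) ^+ 2
  <= (t%:R + psum (fun k => p k ^+ 2) t) / gram_det p t * gram_quad p e t.
Proof.
move=> D0; rewrite -subr_ge0 /gram_quad.
set q := psum (fun k => p k ^+ 2) t; set s := psum p t; set g := psum e t.
set h := psum _ t.
have := D0; rewrite /gram_det -/q -/s => D1.
rewrite (_ : _ - _ = (g ^+ 2 + h ^+ 2) / (t%:R * q - s ^+ 2)); last first.
  by field; rewrite gt_eqF.
apply: divr_ge0; last exact: ltW.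
by apply: addr_ge0; exact: sqr_ge0.
Qed.

Lemma psum_sqr_le (R : realType) (p : nat -> R) (Pb : R) (t : nat) :
  (forall k, (1 <= k)%N -> `|p k| <= Pb) ->
  psum (fun k => p k ^+ 2) t <= t%:R * Pb ^+ 2.
Proof.
move=> pP; elim: t => [|t IH]; first by rewrite psum0 mul0r.
rewrite psumS -natr1 mulrDl mul1r lerD//.
by rewrite -real_normK ?num_real// lerXn2r ?nnegrE// ?pP// (le_trans _ (pP t.+1 _)).
Qed.

Lemma clamp_in (R : realType) (lo hi x : R) : lo <= hi -> lo <= clamp lo hi x <= hi.
Proof. by move=> h; rewrite /clamp le_max lexx orbT ge_max ge_min lexx orbT. Qed.

Lemma clamp_sqr_le (R : realType) (lo hi x y : R) : lo <= x <= hi ->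
  (clamp lo hi y - x) ^+ 2 <= (y - x) ^+ 2.
Proof.
move=> /andP[lx xh]; rewrite /clamp.
have sq (z : R) : 0 <= (y - z) * (y + z - 2 * x) -> (z - x) ^+ 2 <= (y - x) ^+ 2.
  by move=> h; rewrite -subr_ge0; have -> : (y - x) ^+ 2 - (z - x) ^+ 2
    = (y - z) * (y + z - 2 * x) by ring.
case: (leP y hi) => yh.
- case: (leP y lo) => h; last by [].
  by apply: sq; apply: mulr_le0; lra.
- case: (leP hi lo) => h; apply: sq; nra.
Qed.

(** * The estimated optimization problem *)

Definition lsum {R : realType} {N : nat} (g : 'I_N -> 'I_N -> R) : R :=
  \sum_(i < N) \sum_(j < N | j != i) g i j.

Lemma lsumD (R : realType) (N : nat) (g h : 'I_N -> 'I_N -> R) :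
  lsum (fun i j => g i j + h i j) = lsum g + lsum h.
Proof. by rewrite /lsum -big_split; apply: eq_bigr => i _; rewrite big_split. Qed.

Lemma lsumZ (R : realType) (N : nat) (k : R) (g : 'I_N -> 'I_N -> R) :
  lsum (fun i j => k * g i j) = k * lsum g.
Proof. by rewrite /lsum mulr_sumr; apply: eq_bigr => i _; rewrite mulr_sumr. Qed.

Lemma ler_lsum (R : realType) (N : nat) (g h : 'I_N -> 'I_N -> R) :
  (forall i j, i != j -> g i j <= h i j) -> lsum g <= lsum h.
Proof.
by move=> gh; apply: ler_sum => i _; apply: ler_sum => j ji; rewrite gh// eq_sym.
Qed.

Lemma eq_lsum (R : realType) (N : nat) (g h : 'I_N -> 'I_N -> R) :
  (forall i j, i != j -> g i j = h i j) -> lsum g = lsum h.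
Proof.
by move=> gh; apply: eq_bigr => i _; apply: eq_bigr => j ji; rewrite gh// eq_sym.
Qed.

Lemma lsum_ge0 (R : realType) (N : nat) (g : 'I_N -> 'I_N -> R) :
  (forall i j, i != j -> 0 <= g i j) -> 0 <= lsum g.
Proof.
by move=> g0; apply: sumr_ge0 => i _; apply: sumr_ge0 => j ji; rewrite g0// eq_sym.
Qed.

Lemma ler_lsum_term (R : realType) (N : nat) (g : 'I_N -> 'I_N -> R) (i j : 'I_N) :
  (forall k l, k != l -> 0 <= g k l) -> i != j -> g i j <= lsum g.
Proof.
move=> g0 ij; rewrite /lsum (bigD1 i)//= (bigD1 j) 1?eq_sym//= -addrA lerDl addr_ge0//.
  by apply: sumr_ge0 => l /andP[li _]; rewrite g0// eq_sym.
apply: sumr_ge0 => k _; apply: sumr_ge0 => l lk; rewrite g0//.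
by rewrite eq_sym.
Qed.

(** * Reduction to a strongly concave program in the supplies *)

Lemma bounded_integrable (R : realType) (dm : measure_display)
    (Omega : measurableType dm) (P : probability Omega R) (X : Omega -> R) (B : R) :
  measurable_fun setT X -> (forall om, `|X om| <= B) ->
  P.-integrable setT (EFin \o X).
Proof.
move=> mX XB; apply: measurable_bounded_integrable => //.
  by rewrite (le_lt_trans (probability_le1 _ _))// ltry.
by exists B; split; [rewrite num_real|move=> M BM om _ /=; exact: le_trans (XB om) (ltW BM)].
Qed.

(** The estimated problem ties the supply to the mean demand, so expected sales are the supply plus
    this constant of the link, whatever the supply is. This is what makes the objective
    quadratic. *)
Definition mean_shortfall {R : realType} {dm : measure_display}
    {Omega : measurableType dm} (P : probability Omega R) (X : Omega -> R) : R :=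
  fine 'E_P[fun om => Num.min (X om) 0].

Lemma expected_sales (R : realType) (dm : measure_display)
    (Omega : measurableType dm) (P : probability Omega R) (X : Omega -> R) (B w : R) :
  measurable_fun setT X -> (forall om, `|X om| <= B) ->
  fine 'E_P[fun om => Num.min (w + X om) w] = w + mean_shortfall P X.
Proof.
move=> mX XB.
have -> : (fun om => Num.min (w + X om) w) = cst w \+ (fun om => Num.min (X om) 0).
  by apply/funext => om /=; rewrite addr_minr addr0.
have iX : P.-integrable setT (EFin \o (fun om => Num.min (X om) 0)).
  apply: (@bounded_integrable _ _ _ _ _ B).
    by apply: measurable_minr => //; exact: measurable_cst.
  move=> om; case: (leP (X om) 0) => _; first exact: XB.
  by rewrite normr0 (le_trans _ (XB om)).
rewrite expectationD; last 2 first.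
- by apply/Lfun1_integrable; exact: finite_measure_integrable_cst.
- exact/Lfun1_integrable.
rewrite expectation_cst fineD//=.
by rewrite expectation_fin_num//; exact/Lfun1_integrable.
Qed.

(** The contribution of one link with the price eliminated through [p = (a - w) / b]; [mu] is the
    mean shortfall. It is quadratic in [w] with leading coefficient [- xi / b]. *)
Definition link_profit {R : realType} (xi mu c a b w : R) : R :=
  xi * (w + mu) * ((a - w) / b) - xi * w * c.

Lemma link_profit_mid (R : realType) (xi mu c a b v w : R) : b != 0 ->
  link_profit xi mu c a b ((v + w) / 2) =
  (link_profit xi mu c a b v + link_profit xi mu c a b w) / 2
  + xi * (v - w) ^+ 2 / (4 * b).
Proof. by move=> b0; rewrite /link_profit; field. Qed.

(* The price cap [p <= pmax] reads [ah - bh * pmax <= v] in terms of the supply. *)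
Definition supply_ok {R : realType} {N : nat} (pmax : R)
  (ah bh v : 'I_N -> 'I_N -> R) : Prop :=
  (forall i : 'I_N, \sum_(j < N | j != i) v i j = \sum_(j < N | j != i) v j i) /\
  (forall i j, i != j -> 0 <= v i j /\ ah i j - bh i j * pmax <= v i j).

Definition supply_opt {R : realType} {N : nat} (xi mu : 'I_N -> 'I_N -> R) (c pmax : R)
  (ah bh w : 'I_N -> 'I_N -> R) : Prop :=
  supply_ok pmax ah bh w /\
  forall v, supply_ok pmax ah bh v ->
    lsum (fun i j => link_profit (xi i j) (mu i j) c (ah i j) (bh i j) (v i j)) <=
    lsum (fun i j => link_profit (xi i j) (mu i j) c (ah i j) (bh i j) (w i j)).

Lemma is_optimal_supply (R : realType) (N : nat) (dm : measure_display)
    (Omega : measurableType dm) (P : probability Omega R)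
    (eps : 'I_N -> 'I_N -> nat -> Omega -> R) (B : R)
    (xi : 'I_N -> 'I_N -> R) (c pmax : R) (ah bh p w : 'I_N -> 'I_N -> R) :
  (forall i j, i != j -> measurable_fun setT (eps i j 1%N) /\
     forall om, `|eps i j 1%N om| <= B) ->
  (forall i j, i != j -> 0 < bh i j) ->
  is_optimal P eps xi c pmax ah bh p w ->
  supply_opt xi (fun i j => mean_shortfall P (eps i j 1%N)) c pmax ah bh w /\
  (forall i j, i != j -> p i j = (ah i j - w i j) / bh i j).
Proof.
move=> epsP b0 [[wc wP] opt].
have obj p' w' : feasible ah bh pmax p' w' ->
    objective P eps xi c ah bh p' w' =
    lsum (fun i j => link_profit (xi i j) (mean_shortfall P (eps i j 1%N)) c
                       (ah i j) (bh i j) (w' i j)).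
  move=> [_ fP]; apply: eq_lsum => i j ij.
  have [wE _ _] := fP _ _ ij; have [me be] := epsP _ _ ij.
  rewrite -wE (@expected_sales _ _ _ _ _ B)// /link_profit.
  have -> : p' i j = (ah i j - w' i j) / bh i j; last by [].
  by rewrite wE; field; rewrite gt_eqF ?b0.
split; last by move=> i j ij; have [-> _ _] := wP _ _ ij; field; rewrite gt_eqF ?b0.
split.
  split=> // i j ij; have [wE pm w0] := wP _ _ ij; split=> //.
  by rewrite wE lerD2l lerN2 ler_pM2l ?b0.
move=> v [vc vP].
pose p' i j := (ah i j - v i j) / bh i j.
have fv : feasible ah bh pmax p' v.
  split=> // i j ij; have [v0 vm] := vP _ _ ij; have bij := b0 _ _ ij.
  split=> //; first by rewrite /p'; field; rewrite gt_eqF.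
  by rewrite /p' ler_pdivrMr// mulrC; lra.
by rewrite -(obj _ _ fv) -(obj p w)//; exact: opt.
Qed.

(** The optimum [w] is compared with the midpoint of [v] and [w], which is again admissible. The
    midpoint excess of [link_profit_mid], doubled, is the quadratic term on the left. *)
Lemma supply_opt_gap (R : realType) (N : nat) (xi mu : 'I_N -> 'I_N -> R) (c pmax : R)
    (ah bh w v : 'I_N -> 'I_N -> R) :
  (forall i j, i != j -> 0 < bh i j) ->
  supply_opt xi mu c pmax ah bh w -> supply_ok pmax ah bh v ->
  lsum (fun i j => xi i j * (v i j - w i j) ^+ 2 / (2 * bh i j)) <=
    lsum (fun i j => link_profit (xi i j) (mu i j) c (ah i j) (bh i j) (w i j)) -
    lsum (fun i j => link_profit (xi i j) (mu i j) c (ah i j) (bh i j) (v i j)).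
Proof.
move=> b0 [[wc wP] opt] [vc vP].
have mok : supply_ok pmax ah bh (fun i j => (v i j + w i j) / 2).
  split=> [i|i j ij].
    by rewrite -!mulr_suml !big_split/= vc wc.
  by have [? ?] := wP _ _ ij; have [? ?] := vP _ _ ij; split; lra.
have := opt _ mok.
rewrite (@eq_lsum _ _ _ (fun i j =>
   2^-1 * (link_profit (xi i j) (mu i j) c (ah i j) (bh i j) (v i j)
           + link_profit (xi i j) (mu i j) c (ah i j) (bh i j) (w i j))
   + 2^-1 * (xi i j * (v i j - w i j) ^+ 2 / (2 * bh i j)))); last first.
  move=> i j ij; have bij : bh i j != 0 by rewrite gt_eqF ?b0.
  by rewrite link_profit_mid//; field.
rewrite lsumD !lsumZ lsumD; lra.
Qed.

(** Coercivity: the profit of [w] is at most a constant minus a weighted sum of squares of [w], and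
    optimality bounds it below by the profit of one fixed competitor. *)
Lemma supply_opt_bounded (R : realType) (N : nat) (xi mu : 'I_N -> 'I_N -> R)
    (amin amax bmin bmax pmax c : R) :
  0 < amin -> amin <= amax -> 0 < bmin -> bmin <= bmax -> 0 < c -> 0 < pmax ->
  (forall i j, i != j -> 0 < xi i j) ->
  exists2 W : R, 0 < W & forall ah bh w : 'I_N -> 'I_N -> R,
    (forall i j, i != j ->
       amin <= ah i j <= amax /\ bmin <= bh i j <= bmax) ->
    supply_opt xi mu c pmax ah bh w ->
    forall i j, i != j -> w i j <= W.
Proof.
move=> amin0 aa bmin0 bb c0 pm0 xi0.
have bmax0 : 0 < bmax := lt_le_trans bmin0 bb.
have amax0 : 0 < amax := lt_le_trans amin0 aa.
pose K := lsum (fun i j => xi i j * ((amax + `|mu i j|) * (amax / bmin) + amax * c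
   + (amax ^+ 2 + mu i j ^+ 2) / (2 * bmin))).
have K0 : 0 <= K.
  apply: lsum_ge0 => i j ij; apply: mulr_ge0; first exact/ltW/xi0.
  rewrite !addr_ge0 ?mulr_ge0 ?addr_ge0 ?sqr_ge0 ?(ltW amax0) ?(ltW c0)//.
    by rewrite invr_ge0 ltW.
  by rewrite invr_ge0 mulr_ge0 ?(ltW bmin0).
pose M i j := 2 * bmax * K / xi i j.
have M0 i j : i != j -> 0 <= M i j.
  by move=> ij; rewrite divr_ge0 ?mulr_ge0 ?(ltW bmax0)// ltW// xi0.
exists (1 + lsum M); first by rewrite ltr_pwDl// lsum_ge0.
move=> ah bh w box [[wc wP] opt] i j ij.
(* A constant supply is balanced, and the value [amax] meets the price cap for every estimate in the
   box, so one competitor serves them all. *)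
have okc : supply_ok pmax ah bh (fun _ _ => amax).
  split=> // k l kl; have [/andP[? ?] /andP[? ?]] := box _ _ kl; split; first exact: ltW.
  by rewrite lerBlDr (le_trans (y := amax))// lerDl mulr_ge0 ?(ltW pm0)//; lra.
have lo : - lsum (fun i j => xi i j * ((amax + `|mu i j|) * (amax / bmin) + amax * c))
   <= lsum (fun i j => link_profit (xi i j) (mu i j) c (ah i j) (bh i j) amax).
  rewrite -mulN1r -lsumZ; apply: ler_lsum => k l kl.
  have [/andP[a1 a2] /andP[b1 b2]] := box _ _ kl.
  rewrite (_ : link_profit _ _ _ _ _ _ = xi k l *
    (- ((amax + mu k l) * ((amax - ah k l) / bh k l)) - amax * c)); last first.
    by rewrite /link_profit; ring.
  rewrite mulN1r -mulrN ler_pM2l ?xi0// opprD lerD2r lerN2.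
  have b0 : 0 < bh k l := lt_le_trans bmin0 b1.
  apply: (@le_trans _ _ ((amax + `|mu k l|) * ((amax - ah k l) / bh k l))).
    apply: ler_wpM2r; last by rewrite lerD2l ler_norm.
    by rewrite mulr_ge0 ?subr_ge0// invr_ge0 ltW.
  rewrite ler_wpM2l ?addr_ge0 ?(ltW amax0)//.
  rewrite ler_pM ?subr_ge0 ?invr_ge0 ?(ltW b0)//; first by lra.
  by rewrite lef_pV2 ?posrE.
have up : lsum (fun i j => link_profit (xi i j) (mu i j) c (ah i j) (bh i j) (w i j))
   <= lsum (fun i j => xi i j * ((amax ^+ 2 + mu i j ^+ 2) / (2 * bmin)))
      + (-1) * lsum (fun i j => xi i j * (w i j ^+ 2 / (2 * bmax))).
  rewrite -lsumZ -lsumD; apply: ler_lsum => k l kl.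
  have [/andP[a1 a2] /andP[b1 b2]] := box _ _ kl; have [w0 _] := wP _ _ kl.
  have b0 : 0 < bh k l := lt_le_trans bmin0 b1.
  have x0 := xi0 _ _ kl.
  apply: (@le_trans _ _ (xi k l * ((w k l + mu k l) * ((ah k l - w k l) / bh k l)))).
    rewrite -subr_ge0 (_ : _ - _ = xi k l * w k l * c).
      by rewrite !mulr_ge0// ltW.
    by rewrite /link_profit; ring.
  rewrite mulN1r -mulrBr ler_pM2l//.
  (* Completing the square in [(w + mu) * (ah - w)] keeps half of the term [- w ^+ 2]. *)
  apply: (@le_trans _ _ ((ah k l ^+ 2 + mu k l ^+ 2) / (2 * bh k l)
                         - w k l ^+ 2 / (2 * bh k l))).
    rewrite -subr_ge0.
    rewrite (_ : _ - _ = (w k l - (ah k l - mu k l)) ^+ 2 / (2 * bh k l)).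
      by rewrite divr_ge0 ?sqr_ge0// mulr_ge0// ltW.
    by field; rewrite gt_eqF.
  apply: lerB.
    rewrite ler_pM ?addr_ge0 ?sqr_ge0 ?invr_ge0 ?mulr_ge0 ?(ltW b0)//.
      by rewrite lerD2r lerXn2r ?nnegrE//; lra.
    by rewrite lef_pV2 ?posrE ?mulr_gt0// ler_pM2l.
  by rewrite ler_wpM2l ?sqr_ge0// lef_pV2 ?posrE ?mulr_gt0// ler_pM2l.
have KE : K = lsum (fun i j => xi i j * ((amax + `|mu i j|) * (amax / bmin) + amax * c))
   + lsum (fun i j => xi i j * ((amax ^+ 2 + mu i j ^+ 2) / (2 * bmin))).
  by rewrite -lsumD; apply: eq_lsum => k l _; rewrite -mulrDr.
have sw : lsum (fun i j => xi i j * (w i j ^+ 2 / (2 * bmax))) <= K.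
  by have := opt _ okc; rewrite KE; lra.
have x0 := xi0 _ _ ij.
have wM : w i j ^+ 2 <= M i j.
  rewrite /M ler_pdivlMr//.
  have -> : w i j ^+ 2 * xi i j = 2 * bmax * (xi i j * (w i j ^+ 2 / (2 * bmax))).
    by field; rewrite gt_eqF.
  rewrite ler_wpM2l ?mulr_ge0 ?(ltW bmax0)//; apply: le_trans sw.
  apply: (@ler_lsum_term _ _ (fun i j => xi i j * (w i j ^+ 2 / (2 * bmax)))) => // k l kl.
  apply: mulr_ge0; first exact/ltW/xi0.
  by rewrite divr_ge0 ?sqr_ge0// mulr_ge0// ltW.
have := M0 _ _ ij; have := ler_lsum_term _ _ _ _ _ M0 ij; have := sqr_ge0 (w i j - 1); lra.
Qed.

(** The second profit is taken at the raised supply [w + T * r] because this is the circulation that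
    stays admissible once the parameters have moved by [r]. [H] bounds the linear factors of both
    numerators, using [r <= 1]. *)
Lemma link_profit_lip (R : realType) (mu amax bmin c W T : R) :
  0 <= amax -> 0 < bmin -> 0 <= c -> 0 <= W -> 0 <= T ->
  exists2 L : R, 0 <= L & forall xi a a' b b' w r : R,
    0 < xi -> 0 <= a <= amax -> 0 <= a' <= amax -> bmin <= b -> bmin <= b' ->
    0 <= w <= W -> 0 <= r <= 1 -> `|a - a'| <= r -> `|b - b'| <= r ->
    link_profit xi mu c a b w - link_profit xi mu c a' b' (w + T * r) <= xi * (L * r).
Proof.
move=> am0 bm0 c0 W0 T0.
pose H := W + T + `|mu| + amax.
have H0 : 0 <= H by rewrite !addr_ge0.
exists (H * (1 + 2 * T) / bmin + H ^+ 2 / bmin ^+ 2 + c * T).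
  by rewrite !addr_ge0 ?divr_ge0 ?mulr_ge0 ?sqr_ge0 ?addr_ge0 ?mulr_ge0 ?(ltW bm0).
move=> xi a a' b b' w r xi0 /andP[a0 aM] /andP[a'0 a'M] bb bb' /andP[w0 wW]
  /andP[r0 r1] aa' bb'r.
have b0 : 0 < b := lt_le_trans bm0 bb.
have b'0 : 0 < b' := lt_le_trans bm0 bb'.
have Tr : T * r <= T by rewrite ler_piMr.
have Tr0 : 0 <= T * r by rewrite mulr_ge0.
have mu1 := ler_norm mu; have mu2 := ler_norm (- mu); rewrite normrN in mu2.
pose X := (w + mu) * (a - w); pose X' := (w + T * r + mu) * (a' - (w + T * r)).
have hA : `|w + mu| <= H by rewrite ler_norml /H; apply/andP; split; lra.
have hA' : `|w + T * r + mu| <= H by rewrite ler_norml /H; apply/andP; split; lra.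
have hB' : `|a' - (w + T * r)| <= H by rewrite ler_norml /H; apply/andP; split; lra.
have X'H : `|X'| <= H ^+ 2 by rewrite normrM expr2 ler_pM.
have XX' : X - X' <= H * (1 + 2 * T) * r.
  have -> : X - X' = (w + mu) * (a - a' + T * r) - T * r * (a' - (w + T * r)).
    by rewrite /X /X'; ring.
  rewrite (le_trans (ler_norm _))// (le_trans (ler_normB _ _))//.
  rewrite normrM [`|T * r * _|]normrM (ger0_norm Tr0).
  have : `|w + mu| * `|a - a' + T * r| <= H * (r + T * r).
    rewrite ler_pM// (le_trans (ler_normD _ _))// lerD//.
    by rewrite ger0_norm.
  have : T * r * `|a' - (w + T * r)| <= T * r * H by rewrite ler_wpM2l.
  lra.
have hdiv : X / b - X' / b' <= (H * (1 + 2 * T) / bmin + H ^+ 2 / bmin ^+ 2) * r.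
  have -> : X / b - X' / b' = (X - X') / b + X' * (b' - b) / (b * b').
    by field; rewrite !gt_eqF.
  rewrite [leRHS]mulrDl lerD//.
    apply: (@le_trans _ _ (H * (1 + 2 * T) * r / b)).
      by rewrite ler_wpM2r// invr_ge0 ltW.
    rewrite mulrAC ler_wpM2r// ler_wpM2l ?mulr_ge0 ?addr_ge0 ?mulr_ge0//.
    by rewrite lef_pV2 ?posrE.
  rewrite (le_trans (ler_norm _))// normrM [`|X' * _|]normrM mulrAC.
  apply: ler_pM; rewrite ?[`|b' - b|]distrC// ?mulr_ge0//.
  apply: ler_pM => //; rewrite normfV gtr0_norm ?mulr_gt0//.
  by rewrite lef_pV2 ?posrE ?mulr_gt0 ?exprn_gt0// expr2 ler_pM// ltW.
rewrite /link_profit.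
have -> : xi * (w + mu) * ((a - w) / b) - xi * w * c -
  (xi * (w + T * r + mu) * ((a' - (w + T * r)) / b') - xi * (w + T * r) * c)
  = xi * (X / b - X' / b' + c * T * r) by rewrite /X /X'; ring.
by rewrite ler_pM2l// mulrDl lerD2r.
Qed.

(* Adding [T r] to every link turns a circulation admissible for one parameter
   into one admissible for any parameter at distance [r]; strong concavity then
   bounds the distance between the two optima. *)
Lemma supply_opt_holder (R : realType) (N : nat) (xi mu : 'I_N -> 'I_N -> R)
    (amin amax bmin bmax pmax c : R) :
  0 < amin -> amin <= amax -> 0 < bmin -> bmin <= bmax -> 0 < c -> 0 < pmax ->
  (forall i j, i != j -> 0 < xi i j) ->
  exists2 C : R, 0 <= C & forall (ah bh ah' bh' w w' : 'I_N -> 'I_N -> R) (r : R),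
    (forall i j, i != j ->
       amin <= ah i j <= amax /\ bmin <= bh i j <= bmax) ->
    (forall i j, i != j ->
       amin <= ah' i j <= amax /\ bmin <= bh' i j <= bmax) ->
    0 <= r <= 1 ->
    (forall i j, i != j -> `|ah i j - ah' i j| <= r /\ `|bh i j - bh' i j| <= r) ->
    supply_opt xi mu c pmax ah bh w -> supply_opt xi mu c pmax ah' bh' w' ->
    forall i j, i != j -> (w i j - w' i j) ^+ 2 <= C * r.
Proof.
move=> amin0 aa bmin0 bb c0 pm0 xi0.
have bmax0 : 0 < bmax := lt_le_trans bmin0 bb.
have amax0 : 0 < amax := lt_le_trans amin0 aa.
have [W W0 WP] := @supply_opt_bounded R N xi mu _ _ _ _ _ _ amin0 aa bmin0 bb c0 pm0 xi0.
(* The lower bound [ah - bh * pmax] on the supply moves by at most [(1 + pmax) * r]. *)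
pose T := 1 + pmax; have T0 : 0 < T by rewrite addr_gt0.
have /choice[L LP] : forall ij : 'I_N * 'I_N, exists L : R, 0 <= L /\
  forall xi a a' b b' w r : R,
    0 < xi -> 0 <= a <= amax -> 0 <= a' <= amax -> bmin <= b -> bmin <= b' ->
    0 <= w <= W -> 0 <= r <= 1 -> `|a - a'| <= r -> `|b - b'| <= r ->
    link_profit xi (mu ij.1 ij.2) c a b w
    - link_profit xi (mu ij.1 ij.2) c a' b' (w + T * r) <= xi * (L * r).
  move=> ij.
  by have [L ? ?] := @link_profit_lip R (mu ij.1 ij.2) amax bmin c W T
    (ltW amax0) bmin0 (ltW c0) (ltW W0) (ltW T0); exists L.
pose S := lsum (fun i j => xi i j * L (i, j)).
have S0 : 0 <= S.
  by apply: lsum_ge0 => i j ij; rewrite mulr_ge0 ?(LP _).1// ltW// xi0.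
pose C i j := 8 * bmax * S / xi i j + 2 * T ^+ 2.
have C0 i j : i != j -> 0 <= C i j.
  move=> ij; rewrite addr_ge0 ?divr_ge0 ?mulr_ge0 ?(ltW bmax0) ?(ltW T0) ?sqr_ge0//.
  by rewrite ltW// xi0.
exists (lsum C); first exact: lsum_ge0.
move=> ah bh ah' bh' w w' r box box' r01 hr opt opt' i j ij.
have /andP[r0 r1] := r01.
have shift (a b a' b' v : 'I_N -> 'I_N -> R) :
    (forall i j, i != j -> amin <= a i j <= amax /\ bmin <= b i j <= bmax) ->
    (forall i j, i != j -> `|a i j - a' i j| <= r /\ `|b i j - b' i j| <= r) ->
    supply_ok pmax a' b' v -> supply_ok pmax a b (fun i j => v i j + T * r).
  move=> bx h [vc vP]; split=> [k|k l kl]; first by rewrite !big_split/= vc.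
  have [v0 vl] := vP _ _ kl; split; first by rewrite addr_ge0// mulr_ge0// ltW.
  have [] := h _ _ kl; rewrite !ler_norml => /andP[_ ha] /andP[hb _].
  have : (b' k l - b k l) * pmax <= r * pmax by rewrite ler_wpM2r//; lra.
  by rewrite /T; lra.
have hr' : forall i j, i != j -> `|ah' i j - ah i j| <= r /\ `|bh' i j - bh i j| <= r.
  by move=> k l kl; rewrite distrC [`|bh' k l - _|]distrC; exact: hr.
have bh0 : forall i j, i != j -> 0 < bh i j.
  by move=> k l kl; have [_ /andP[h _]] := box _ _ kl; exact: lt_le_trans h.
have ok1 := shift _ _ _ _ _ box hr opt'.1.
have ok2 := shift _ _ _ _ _ box' hr' opt.1.
have gap := supply_opt_gap _ _ _ _ _ _ _ _ _ _ bh0 opt ok1.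
have opt2 := opt'.2 _ ok2.
have W1 := WP _ _ _ box opt; have W2 := WP _ _ _ box' opt'.
have nn (a b v : 'I_N -> 'I_N -> R) k l : supply_opt xi mu c pmax a b v -> k != l -> 0 <= v k l.
  by move=> [[_ h] _] kl; have [] := h _ _ kl.
have pw (a b : 'I_N -> 'I_N -> R) k l :
  (forall i j, i != j -> amin <= a i j <= amax /\ bmin <= b i j <= bmax) ->
  k != l -> (0 <= a k l <= amax) && (bmin <= b k l).
  move=> bx kl; have [/andP[h1 ->] /andP[-> _]] := bx _ _ kl.
  by rewrite (le_trans (ltW amin0) h1).
have bnd : lsum (fun i j => xi i j * (w' i j + T * r - w i j) ^+ 2 / (2 * bh i j))
   <= 2 * r * S.
  apply: (le_trans gap).
  (* Changing the parameters costs [r * S] in each of [E1] and [E2]; between them, [opt2] compares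
     [w'] with the raised [w] at the second parameter. *)
  have E1 : lsum (fun i j => link_profit (xi i j) (mu i j) c (ah i j) (bh i j) (w i j))
     <= lsum (fun i j => link_profit (xi i j) (mu i j) c (ah' i j) (bh' i j) (w i j + T * r))
        + r * S.
    rewrite -lsumZ -lsumD; apply: ler_lsum => k l kl.
    have /andP[p1 p2] := pw _ _ k l box kl.
    have /andP[p3 p4] := pw _ _ k l box' kl.
    have [h1 h2] := hr _ _ kl.
    have := (LP (k, l)).2 (xi k l) _ _ _ _ (w k l) r (xi0 _ _ kl) p1 p3 p2 p4.
    rewrite (nn _ _ _ _ _ opt kl) W1// => /(_ erefl r01 h1 h2) /=; lra.
  have E2 : lsum (fun i j => link_profit (xi i j) (mu i j) c (ah' i j) (bh' i j) (w' i j))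
     <= lsum (fun i j => link_profit (xi i j) (mu i j) c (ah i j) (bh i j) (w' i j + T * r))
        + r * S.
    rewrite -lsumZ -lsumD; apply: ler_lsum => k l kl.
    have /andP[p1 p2] := pw _ _ k l box kl.
    have /andP[p3 p4] := pw _ _ k l box' kl.
    have [h1 h2] := hr' _ _ kl.
    have := (LP (k, l)).2 (xi k l) _ _ _ _ (w' k l) r (xi0 _ _ kl) p3 p1 p4 p2.
    rewrite (nn _ _ _ _ _ opt' kl) W2// => /(_ erefl r01 h1 h2) /=; lra.
  lra.
have x0 := xi0 _ _ ij; have b0 := bh0 _ _ ij.
have [_ /andP[_ bM]] := box _ _ ij.
have h2 : (w' i j + T * r - w i j) ^+ 2 <= 4 * bmax * r * S / xi i j.
  rewrite ler_pdivlMr// mulrC.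
  have : xi i j * (w' i j + T * r - w i j) ^+ 2 / (2 * bh i j) <= 2 * r * S.
    apply: le_trans bnd.
    apply: (@ler_lsum_term _ _ (fun i j =>
      xi i j * (w' i j + T * r - w i j) ^+ 2 / (2 * bh i j))) => // k l kl.
    apply: divr_ge0; last by rewrite mulr_ge0// ltW// bh0.
    by apply: mulr_ge0; [exact/ltW/xi0|exact: sqr_ge0].
  rewrite ler_pdivrMr ?mulr_gt0// => /le_trans; apply.
  have : bh i j * (r * S) <= bmax * (r * S) by rewrite ler_wpM2r// mulr_ge0.
  lra.
apply: (@le_trans _ _ (C i j * r)); last by rewrite ler_wpM2r// (ler_lsum_term _ _ _ _ _ C0).
have : (T * r) ^+ 2 <= T ^+ 2 * r by rewrite exprMn ler_wpM2l ?sqr_ge0// expr2 ler_piMl.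
(* Undoes the raise through [(z - y)^2 <= 2 z^2 + 2 y^2]; hence the two summands of [C]. *)
have : 0 <= (w' i j + T * r - w i j + T * r) ^+ 2 by exact: sqr_ge0.
have -> : C i j * r = 2 * (4 * bmax * r * S / xi i j) + 2 * (T ^+ 2 * r).
  by rewrite /C; field; rewrite gt_eqF.
move: h2; set z := _ / xi i j; lra.
Qed.

(** * Measurability and independence *)

(** Preimages are countable unions of fibres of [Z], so [g] may be arbitrary. This is what lets the
    unspecified optimal selection be evaluated at quantized estimates. *)
Lemma measurable_countable_comp (d d' : measure_display) (T : measurableType d)
    (T' : measurableType d') (U : countType) (Z : T -> U) (g : U -> T') :
  (forall u, measurable (Z @^-1` [set u])) -> measurable_fun setT (g \o Z).
Proof.
move=> mZ _ B mB; rewrite setTI.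
have -> : (g \o Z) @^-1` B = \bigcup_u (if `[< B (g u) >] then Z @^-1` [set u] else set0).
  apply/seteqP; split=> [x Bx|x [u _]]; first by exists (Z x) => //; rewrite asboolT.
  by case: ifPn => // /asboolP Bu /= ->.
apply: countable_bigcupT_measurable; first exact: countableP.
by move=> u; case: ifPn.
Qed.

Lemma measurable_floor_preimage (R : realType) (d : measure_display)
    (T : measurableType d) (f : T -> R) (n : R) (z : int) :
  measurable_fun setT f -> measurable ((fun x => Num.floor (n * f x)) @^-1` [set z]).
Proof.
move=> mf.
rewrite (_ : _ @^-1` _ = (fun x => n * f x) @^-1` `[z%:~R, (z + 1)%:~R[).
  have mnf : measurable_fun setT (fun x => n * f x).
    by apply: measurable_funM => //; exact: measurable_cst.
  by rewrite -[X in measurable X]setTI; apply: mnf => //; exact: measurable_itv.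
apply/seteqP; split=> x /=; rewrite in_itv/= => h.
  by rewrite -h floor_itv.
by apply/eqP; rewrite floor_eq.
Qed.

Lemma clamp_floor_near (R : realType) (lo hi x : R) (n : nat) :
  lo <= x <= hi ->
  `|clamp lo hi ((Num.floor (n.+1%:R * x))%:~R / n.+1%:R) - x| <= n.+1%:R^-1.
Proof.
move=> xb; have n0 : 0 < n.+1%:R :> R by [].
set y := _ / _.
have yx : `|y - x| <= n.+1%:R^-1.
  have /andP[h1 h2] := floor_itv (n.+1%:R * x).
  have -> : y - x = n.+1%:R^-1 * ((Num.floor (n.+1%:R * x))%:~R - n.+1%:R * x).
    by rewrite /y mulrBr mulKf ?gt_eqF// mulrC.
  rewrite normrM ger0_norm ?invr_ge0// ler_piMr ?invr_ge0// ler_norml.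
  by move: h2; rewrite intrD => h2; apply/andP; split; lra.
rewrite -ler_sqr ?nnegrE ?invr_ge0// real_normK ?num_real//.
apply: le_trans (@clamp_sqr_le _ _ _ _ y xb) _.
by rewrite -[leLHS]real_normK ?num_real// lerXn2r ?nnegrE ?invr_ge0 ?ler0n.
Qed.

(* A function of the estimates that is Hoelder continuous on the box is a limit
   of functions of quantized estimates, which take countably many values; the
   (arbitrary) diagonal entries are overwritten on the way. *)
Lemma measurable_holder_comp (R : realType) (N : nat) (d : measure_display)
    (T : measurableType d) (amin amax bmin bmax C : R)
    (f : ('I_N -> 'I_N -> R) -> ('I_N -> 'I_N -> R) -> R)
    (a b : T -> 'I_N -> 'I_N -> R) :
  amin <= amax -> bmin <= bmax ->
  (forall ah bh ah' bh' (r : R),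
    (forall i j, i != j -> amin <= ah i j <= amax /\ bmin <= bh i j <= bmax) ->
    (forall i j, i != j -> amin <= ah' i j <= amax /\ bmin <= bh' i j <= bmax) ->
    0 <= r <= 1 ->
    (forall i j, i != j -> `|ah i j - ah' i j| <= r /\ `|bh i j - bh' i j| <= r) ->
    (f ah bh - f ah' bh') ^+ 2 <= C * r) ->
  (forall i j, i != j -> measurable_fun setT (fun x => a x i j) /\
                         measurable_fun setT (fun x => b x i j)) ->
  (forall x i j, i != j -> amin <= a x i j <= amax /\ bmin <= b x i j <= bmax) ->
  measurable_fun setT (fun x => f (a x) (b x)).
Proof.
move=> aa bb fH mab box.
pose U : countType := {ffun 'I_N * 'I_N -> int * int}.
(* The default on the diagonal makes [Z n] measurable whatever the diagonal entries of [a] and [b]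
   are; [fH] compares off-diagonal entries only, so the limit is unaffected. *)
pose Z n x : U := [ffun ij => if ij.1 == ij.2 then (0, 0) else
  (Num.floor (n.+1%:R * a x ij.1 ij.2), Num.floor (n.+1%:R * b x ij.1 ij.2))].
pose A n (u : U) i j : R := clamp amin amax ((u (i, j)).1%:~R / n.+1%:R).
pose B n (u : U) i j : R := clamp bmin bmax ((u (i, j)).2%:~R / n.+1%:R).
pose F n x := f (A n (Z n x)) (B n (Z n x)).
apply: (@measurable_fun_cvg _ _ _ _ F) => [n|x _].
  apply: (@measurable_countable_comp _ _ _ _ U (Z n) (fun u => f (A n u) (B n u))) => u.
  have -> : Z n @^-1` [set u] = \bigcap_ij (Z n ^~ ij) @^-1` [set u ij].
    apply/seteqP; split=> [x /= <- //|x /= h].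
    by apply/ffunP => ij; have := h ij I.
  apply: fin_bigcap_measurable; first exact: finite_finset.
  move=> [i j] _; case: (eqVneq i j) => [<-|ij].
    have [h|h] := pselect ((0, 0) = u (i, i)).
      rewrite (_ : _ @^-1` _ = setT)//; apply/seteqP; split=> // x _ /=.
      by rewrite ffunE /= eqxx -h.
    rewrite (_ : _ @^-1` _ = set0)//; apply/seteqP; split=> // x /=.
    by rewrite ffunE /= eqxx.
  have [ma mb] := mab _ _ ij.
  rewrite (_ : _ @^-1` _ =
     ((fun x => Num.floor (n.+1%:R * a x i j)) @^-1` [set (u (i, j)).1]) `&`
     ((fun x => Num.floor (n.+1%:R * b x i j)) @^-1` [set (u (i, j)).2])).
    by apply: measurableI; exact: measurable_floor_preimage.
  apply/seteqP; split=> x /=; rewrite ffunE /= (negbTE ij).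
    by move=> <-.
  by case: (u _) => u1 u2 /= [-> ->].
have FC n : (F n x - f (a x) (b x)) ^+ 2 <= C * n.+1%:R^-1.
  apply: fH => [i j ij|i j ij||i j ij].
  - by rewrite !clamp_in.
  - exact: box.
  - by rewrite invr_ge0 ler0n/= invf_le1// ler1n.
  - have [ba bb'] := box x _ _ ij.
    by rewrite /A /B /Z !ffunE /= (negbTE ij) /= !clamp_floor_near.
apply/cvgrPdist_le => e e0.
have : (fun n => C * n.+1%:R^-1 : R) @ \oo --> C * 0.
  by apply: cvgMr; exact: cvg_harmonic.
rewrite mulr0 => /cvgrPdist_le /(_ (e ^+ 2) (exprn_gt0 _ e0)).
apply: filterS => n; rewrite sub0r normrN => h.
rewrite distrC -ler_sqr ?nnegrE ?(ltW e0)// real_normK ?num_real//.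
by rewrite (le_trans (FC n))// (le_trans (ler_norm _)).
Qed.

Lemma measurable_pos_inv (R : realType) (d : measure_display) (T : measurableType d)
    (f : T -> R) :
  measurable_fun setT f -> (forall x, 0 < f x) -> measurable_fun setT (fun x => (f x)^-1).
Proof.
move=> mf f0.
under eq_fun do rewrite -powR_inv1 ?(ltW (f0 _))//.
exact: (measurableT_comp (@measurable_powR R (-1)) mf).
Qed.

Lemma measurable_clamp (R : realType) (d : measure_display) (T : measurableType d)
    (lo hi : R) (f : T -> R) :
  measurable_fun setT f -> measurable_fun setT (fun x => clamp lo hi (f x)).
Proof.
move=> mf; apply: measurable_maxr; last exact: measurable_cst.
by apply: measurable_minr => //; exact: measurable_cst.
Qed.

Lemma clamp_id (R : realType) (B x : R) : `|x| <= B -> clamp (- B) B x = x.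
Proof.
rewrite ler_norml => /andP[h1 h2]; rewrite /clamp.
by rewrite (min_idPl h2) (max_idPl h1).
Qed.

Lemma clamp_sym_le (R : realType) (B u : R) : `|clamp (- B) B u| <= `|B|.
Proof.
  rewrite /clamp; case: (leP u B) => h1.
    case: (leP u (- B)) => h2; rewrite ?normrN//.
    by rewrite ler_norml; apply/andP; split; have := ler_norm B; lra.
  by case: (leP B (- B)); rewrite ?normrN.
Qed.

(** Independence identifies the law of the pair with the product law, since rectangles determine it;
    Fubini then leaves the mean of [Y] as inner integral. *)
Lemma integral_mul_indep (R : realType) (d : measure_display) (T : measurableType d)
    (P : probability T R) (X Y : T -> R) (B : R) :
  measurable_fun setT X -> measurable_fun setT Y ->
  (forall x, `|X x| <= B) -> (forall x, `|Y x| <= B) ->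
  (forall A C : set R, measurable A -> measurable C ->
     P (X @^-1` A `&` Y @^-1` C) = (P (X @^-1` A) * P (Y @^-1` C))%E) ->
  ('E_P[Y] = 0)%E -> (\int[P]_x (X x * Y x)%:E = 0)%E.
Proof.
move=> mX mY XB YB ind EY.
pose X' : {RV P >-> R} := mfun_Sub (mem_set mX).
pose Y' : {RV P >-> R} := mfun_Sub (mem_set mY).
have mXY : measurable_fun setT (fun x => (X x, Y x)).
  exact/measurable_fun_pairP.
pose XY : {RV P >-> (R * R)%type} := mfun_Sub (mem_set mXY).
(* Truncation makes the product a bounded function on the whole plane, integrable for the product
   law, without changing it at the values taken by [(X, Y)]. *)
pose cl := clamp (- B) B.
have mcl : measurable_fun setT cl by apply: measurable_clamp; exact: measurable_id.
pose f (z : R * R) := (cl z.1 * cl z.2)%:E.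
have mf : measurable_fun setT f.
  apply/measurable_EFinP; apply: measurable_funM.
    by apply: measurableT_comp => //; exact: measurable_fst.
  by apply: measurableT_comp => //; exact: measurable_snd.
have E1 : (\int[P]_x (X x * Y x)%:E = \int[distribution P XY]_z f z)%E.
  rewrite integral_distribution//; last first.
    apply: (@bounded_integrable _ _ _ _ (fun x => cl (X x) * cl (Y x)) (B * B)).
      by apply: measurable_funM; exact: measurableT_comp.
    by move=> x; rewrite /cl !clamp_id// normrM ler_pM.
  by apply: eq_integral => x _; rewrite /f /= /cl !clamp_id.
rewrite E1.
have B0 : forall x : T, 0 <= B by move=> x; exact: le_trans (XB x).
have -> : (\int[distribution P XY]_z f z =
           \int[distribution P X' \x distribution P Y']_z f z)%E.
  apply: eq_measure_integral => A mA _; apply/esym.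
  by apply: product_measure_unique => // A1 A2 mA1 mA2; exact: ind.
have clB u : `|cl u| <= `|B| by exact: clamp_sym_le.
rewrite -fubini1; last first.
  apply/(@measurable_bounded_integrable _ _ _ _ (fun z => cl z.1 * cl z.2)) => //.
  - have h : (distribution P X' \x distribution P Y')%E setT = 1%E.
      by rewrite -setXTT product_measure1E//= !probability_setT mule1.
    by rewrite [ltLHS]h ltry.
  - exact/measurable_EFinP.
  - exists (`|B| * `|B|); split; first by rewrite num_real.
    by move=> M BM z _ /=; apply: le_trans (ltW BM); rewrite normrM ler_pM.
have E2 x : fubini_F (distribution P Y') f x = 0%E.
  rewrite /fubini_F /f; under eq_integral do rewrite EFinM /=.
  rewrite (@integralZl _ _ _ _ _ _ (EFin \o cl))//=; last exact: (@bounded_integrable _ _ _ _ _ `|B|).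
  rewrite (integral_distribution (f := EFin \o cl)); last 2 first.
  - exact/measurable_EFinP.
  - apply: (@bounded_integrable _ _ _ _ (cl \o Y) `|B|) => [|y].
      exact: (measurableT_comp mcl mY).
    exact: clB.
  transitivity ((cl x)%:E * 'E_P[Y])%E; last by rewrite EY mule0.
  by congr (_ * _)%E; rewrite unlock; apply: eq_integral => y _ /=; rewrite /cl clamp_id.
by rewrite integral0_eq// => x _; exact: E2.
Qed.

(** * Measurability and boundedness of the least-squares quantities *)

Lemma measurable_psum (R : realType) (d : measure_display) (T : measurableType d)
    (u : nat -> T -> R) (t : nat) :
  (forall k, (1 <= k <= t)%N -> measurable_fun setT (u k)) ->
  measurable_fun setT (fun x => psum (fun k => u k x) t).
Proof.
elim: t => [|t IH] mu; first by under eq_fun do rewrite psum0; exact: measurable_cst.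
under eq_fun do rewrite psumS.
apply: measurable_funD; last by apply: mu; rewrite leqnn.
by apply: IH => k /andP[k1 kt]; apply: mu; rewrite k1 leqW.
Qed.

Lemma measurable_gram_det (R : realType) (d : measure_display) (T : measurableType d)
    (p : nat -> T -> R) (t : nat) :
  (forall k, (1 <= k <= t)%N -> measurable_fun setT (p k)) ->
  measurable_fun setT (fun x => gram_det (p^~ x) t).
Proof.
move=> mp; apply: measurable_funB.
  apply: measurable_funM; first exact: measurable_cst.
  by apply: (@measurable_psum _ _ _ (fun k x => p k x ^+ 2)) => k kt;
    apply: measurable_funX; exact: mp.
by apply: measurable_funX; exact: measurable_psum.
Qed.

Lemma measurable_gram_incr (R : realType) (d : measure_display) (T : measurableType d)
    (p e : nat -> T -> R) (t : nat) :
  (forall k, (1 <= k <= t.+1)%N -> measurable_fun setT (p k)) ->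
  (forall k, (1 <= k <= t)%N -> measurable_fun setT (e k)) ->
  (forall x, 0 < gram_det (p^~ x) t.+1) ->
  measurable_fun setT (fun x => gram_incr (p^~ x) (e^~ x) t).
Proof.
move=> mp me D0.
have mp' k : (1 <= k <= t)%N -> measurable_fun setT (p k).
  by move=> /andP[k1 kt]; apply: mp; rewrite k1 leqW.
have mpS : measurable_fun setT (p t.+1) by apply: mp; rewrite leqnn.
have mE := measurable_psum _ _ _ _ _ me.
have mP := measurable_psum _ _ _ _ _ mp'.
apply: measurable_funM; last first.
  by apply: measurable_pos_inv => //; exact: measurable_gram_det.
apply: measurable_funD; apply: measurable_funM => //.
- apply: measurable_funB; last exact: measurable_funM.
  by apply: (@measurable_psum _ _ _ (fun k x => p k x ^+ 2)) => k kt;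
    apply: measurable_funX; exact: mp'.
- apply: measurable_funB => //.
  by apply: measurable_funM => //; exact: measurable_cst.
- by apply: (@measurable_psum _ _ _ (fun k x => p k x * e k x)) => k kt;
    apply: measurable_funM; [exact: mp'|exact: me].
Qed.

Lemma measurable_lsq (R : realType) (d : measure_display) (T : measurableType d)
    (p e : nat -> T -> R) (t : nat) :
  (forall k, (1 <= k <= t)%N -> measurable_fun setT (p k)) ->
  (forall k, (1 <= k <= t)%N -> measurable_fun setT (e k)) ->
  (forall x, 0 < gram_det (p^~ x) t) ->
  measurable_fun setT (fun x =>
    (psum (fun k => p k x ^+ 2) t * psum (e^~ x) t
     - psum (p^~ x) t * psum (fun k => p k x * e k x) t) / gram_det (p^~ x) t) /\
  measurable_fun setT (fun x =>
    (psum (p^~ x) t * psum (e^~ x) t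
     - t%:R * psum (fun k => p k x * e k x) t) / gram_det (p^~ x) t).
Proof.
move=> mp me D0.
have mE := measurable_psum _ _ _ _ _ me.
have mP := measurable_psum _ _ _ _ _ mp.
have mD : measurable_fun setT (fun x => (gram_det (p^~ x) t)^-1).
  by apply: measurable_pos_inv => //; exact: measurable_gram_det.
have mPP : measurable_fun setT (fun x => psum (fun k => p k x ^+ 2) t).
  by apply: (@measurable_psum _ _ _ (fun k x => p k x ^+ 2)) => k kt;
    apply: measurable_funX; exact: mp.
have mPE : measurable_fun setT (fun x => psum (fun k => p k x * e k x) t).
  by apply: (@measurable_psum _ _ _ (fun k x => p k x * e k x)) => k kt;
    apply: measurable_funM; [exact: mp|exact: me].
split; apply: measurable_funM => //; apply: measurable_funB; exact: measurable_funM.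
Qed.

Lemma psum_norm_le (R : realType) (u : nat -> R) (M : R) (t : nat) :
  (forall k, (1 <= k)%N -> `|u k| <= M) -> `|psum u t| <= t%:R * M.
Proof.
move=> uM; elim: t => [|t IH]; first by rewrite psum0 normr0 mul0r.
by rewrite psumS -natr1 mulrDl mul1r (le_trans (ler_normD _ _))// lerD// uM.
Qed.

(** Only the integrability of the centred terms depends on this, so the bound may grow with [t]. *)
Lemma gram_incr_bounded (R : realType) (Pb B d0 : R) (t : nat) : 0 < d0 ->
  exists M : R, forall p e : nat -> R,
    (forall k, (1 <= k)%N -> `|p k| <= Pb) -> (forall k, (1 <= k)%N -> `|e k| <= B) ->
    d0 <= gram_det p t.+1 -> `|gram_incr p e t| <= M.
Proof.
move=> d00.
exists (((t%:R * Pb ^+ 2 + Pb * (t%:R * Pb)) * (t%:R * B) +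
   (t%:R * Pb + t%:R * Pb) * (t%:R * (Pb * B))) / d0) => p e pP eB dD.
have D0 : 0 < gram_det p t.+1 := lt_le_trans d00 dD.
have h1 : `|psum (fun k => p k ^+ 2) t| <= t%:R * Pb ^+ 2.
  by apply: psum_norm_le => k k1; rewrite normrX lerXn2r ?nnegrE ?pP// (le_trans _ (pP k k1)).
have h2 := psum_norm_le _ _ _ t pP; have h3 := psum_norm_le _ _ _ t eB.
have h4 : `|psum (fun k => p k * e k) t| <= t%:R * (Pb * B).
  by apply: psum_norm_le => k k1; rewrite normrM ler_pM ?pP ?eB.
have h5 : `|p t.+1| <= Pb by exact: pP.
rewrite normrM ler_pM// ?normfV ?(gtr0_norm D0) ?lef_pV2 ?posrE//.
rewrite (le_trans (ler_normD _ _))// lerD// normrM ler_pM//.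
  by rewrite (le_trans (ler_normB _ _))// lerD// normrM ler_pM.
by rewrite (le_trans (ler_normB _ _))// lerD// normrM ger0_norm// ler_wpM2l.
Qed.

(** * Mean squared error of the estimates *)

Lemma integrable_sum_eq0 (R : realType) (d : measure_display) (T : measurableType d)
    (P : probability T R) (f : nat -> T -> R) (m n : nat) :
  (forall k, (m <= k < n)%N ->
     P.-integrable setT (EFin \o f k) /\ (\int[P]_x (f k x)%:E = 0)%E) ->
  P.-integrable setT (EFin \o (fun x => \sum_(m <= k < n) f k x)) /\
  (\int[P]_x (\sum_(m <= k < n) f k x)%:E = 0)%E.
Proof.
have [nm _|mn] := leqP n m.
  rewrite (_ : (fun x => _) = cst 0); last first.
    by apply/funext => x; rewrite big_geq.
  split; first exact: integrable0.
  by under eq_integral do rewrite big_geq//; rewrite integral0.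
elim: n mn => // n IH; rewrite ltnS leq_eqVlt => /orP[/eqP <-|mn] fk.
  have [f1 f2] := fk m (introT andP (conj (leqnn _) (leqnn _))).
  rewrite (_ : (fun x => _) = f m); last by apply/funext => x; rewrite big_nat1.
  by split=> //; under eq_integral do rewrite big_nat1.
have [|I1 I2] := IH mn.
  by move=> k /andP[mk kn]; apply: fk; rewrite mk ltnS ltnW.
have [f1 f2] := fk n (introT andP (conj (ltnW mn) (leqnn _))).
rewrite (_ : (fun x => _) = (fun x => \sum_(m <= k < n) f k x) \+ f n); last first.
  by apply/funext => x; rewrite big_nat_recr// ltnW.
split; first exact: (integrableD measurableT I1 f1).
under eq_integral do rewrite big_nat_recr ?(ltnW mn)//= EFinD.
by rewrite integralD//= I2 f2 adde0.
Qed.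

(** The trace is at most [(1 + Pb^2) * t] and the determinant at least
    [kap^2 / 6 * t * t^(1 - 2 eta)]; the two factors [t] cancel and a deterministic prefactor is
    left. *)
Lemma lsq_error_pathwise (R : realType) (p e : nat -> R) (Pb B kap eta : R) (t : nat) :
  0 < Pb -> 0 < kap -> 0 < eta -> eta < 1 / 2 -> (2 <= t)%N ->
  (forall k, (1 <= k)%N -> `|p k| <= Pb) ->
  (forall k, (1 <= k)%N -> `|e k| <= B) ->
  (forall k, (1 <= k)%N -> kap * k.*2%:R `^ (- eta) <= p k.*2.-1 - p k.*2) ->
  ((psum (fun k => p k ^+ 2) t * psum e t
       - psum p t * psum (fun k => p k * e k) t) / gram_det p t) ^+ 2 +
  ((psum p t * psum e t
       - t%:R * psum (fun k => p k * e k) t) / gram_det p t) ^+ 2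
  <= (1 + Pb ^+ 2) / (kap ^+ 2 / 6 * t%:R `^ (1 - 2 * eta)) *
     (2 * B ^+ 2 + B ^+ 2 * (2 * ln t%:R + ln (Pb ^+ 2) - ln (kap ^+ 2 / 6)))
     + \sum_(2 <= k < t) (2 * ((1 + Pb ^+ 2) / (kap ^+ 2 / 6 * t%:R `^ (1 - 2 * eta)))) *
        (gram_incr p e k * e k.+1).
Proof.
move=> Pb0 kap0 eta0 eta1 t2 pP eB pd.
set cc := kap ^+ 2 / 6; have cc0 : 0 < cc by rewrite divr_gt0// exprn_gt0.
have Dk k : (2 <= k)%N -> cc * k%:R * k%:R `^ (1 - 2 * eta) <= gram_det p k.
  by move=> k2; exact: gram_det_ge.
have pw k : (2 <= k)%N -> 0 < k%:R `^ (1 - 2 * eta) :> R.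
  by move=> k2; rewrite powR_gt0// ltr0n (ltn_trans _ k2).
have D0 k : (2 <= k)%N -> 0 < gram_det p k.
  move=> k2; apply: lt_le_trans (Dk _ k2); rewrite mulr_gt0 ?pw// mulr_gt0//.
  by rewrite ltr0n (ltn_trans _ k2).
have t0 : 0 < t%:R :> R by rewrite ltr0n (ltn_trans _ t2).
apply: (le_trans (lsq_error_le _ _ _ _ (D0 _ t2))).
set c1 := (1 + _) / _.
have Pb1 : 0 < 1 + Pb ^+ 2 by rewrite ltr_wpDr// sqr_ge0.
have c10 : 0 < c1 by rewrite divr_gt0// mulr_gt0// pw.
have q0 : 0 <= psum (fun k => p k ^+ 2) t by apply: sumr_ge0 => k _; exact: sqr_ge0.
have qle := psum_sqr_le _ _ _ t pP.
have fac0 : 0 < (t%:R + psum (fun k => p k ^+ 2) t) / gram_det p t.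
  by rewrite divr_gt0 ?D0// ltr_pwDl.
(* Needed to enlarge the prefactor. The sign is read off from [lsq_error_le], whose left side is a
   sum of squares. *)
have Q0 : 0 <= gram_quad p e t.
  rewrite -(pmulr_rge0 _ fac0); apply: le_trans (lsq_error_le _ _ _ _ (D0 _ t2)).
  by rewrite addr_ge0// sqr_ge0.
have fac : (t%:R + psum (fun k => p k ^+ 2) t) / gram_det p t <= c1.
  rewrite ler_pdivrMr ?D0// /c1 mulrAC ler_pdivlMr ?mulr_gt0 ?pw//.
  apply: (@le_trans _ _ ((1 + Pb ^+ 2) * (cc * t%:R * t%:R `^ (1 - 2 * eta)))).
    rewrite (_ : (1 + Pb ^+ 2) * _ =
      (t%:R + t%:R * Pb ^+ 2) * (cc * t%:R `^ (1 - 2 * eta))); last by ring.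
    apply: ler_wpM2r; first by rewrite mulr_ge0 ?powR_ge0// ltW.
    by rewrite lerD2l.
  by rewrite ler_wpM2l ?(ltW Pb1)// Dk.
apply: (@le_trans _ _ (c1 * gram_quad p e t)); first by rewrite ler_wpM2r.
have QB := gram_quad_bound _ _ _ _ _ eB D0 t2.
have lnD : ln (gram_det p t) <= 2 * ln t%:R + ln (Pb ^+ 2).
  rewrite (_ : 2 * ln t%:R = ln (t%:R ^+ 2)); last by rewrite lnXn// mulr_natl.
  rewrite -lnM ?posrE ?exprn_gt0// ler_ln ?posrE ?mulr_gt0 ?exprn_gt0 ?D0//.
  apply: (@le_trans _ _ (t%:R * psum (fun k => p k ^+ 2) t)).
    by rewrite /gram_det gerBl sqr_ge0.
  by rewrite expr2 -mulrA ler_wpM2l// ltW.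
have lnD2 : ln cc <= ln (gram_det p 2).
  rewrite ler_ln ?posrE ?D0//; apply: le_trans (Dk 2%N erefl).
  rewrite -mulrA ler_peMr ?(ltW cc0)//.
  have : (1 : R) <= 2%:R `^ (1 - 2 * eta).
    by rewrite -[leLHS](powRr0 2%:R) ler_powR//; lra.
  lra.
rewrite -mulr_sumr.
under eq_bigr do rewrite mulrC.
rewrite [2 * c1]mulrC -[c1 * 2 * _]mulrA -mulrDr ler_wpM2l ?(ltW c10)//.
have : B ^+ 2 * (ln (gram_det p t) - ln (gram_det p 2)) <=
   B ^+ 2 * (2 * ln t%:R + ln (Pb ^+ 2) - ln cc) by rewrite ler_wpM2l ?sqr_ge0//; lra.
lra.
Qed.

Lemma lsq_mse (R : realType) (d : measure_display) (T : measurableType d)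
    (P : probability T R) (p e : nat -> T -> R) (Pb B kap eta : R) (t : nat) :
  0 < Pb -> 0 < kap -> 0 < eta -> eta < 1 / 2 -> (2 <= t)%N ->
  (forall k, (1 <= k)%N -> measurable_fun setT (p k)) ->
  (forall k, (1 <= k)%N -> measurable_fun setT (e k)) ->
  (forall k, (1 <= k)%N -> forall x, `|p k x| <= Pb) ->
  (forall k, (1 <= k)%N -> forall x, `|e k x| <= B) ->
  (forall k, (1 <= k)%N -> forall x,
     kap * k.*2%:R `^ (- eta) <= p k.*2.-1 x - p k.*2 x) ->
  (forall k, (2 <= k)%N ->
     (\int[P]_x (gram_incr (p^~ x) (e^~ x) k * e k.+1 x)%:E = 0)%E) ->
  (\int[P]_x (((psum (fun k => p k x ^+ 2) t * psum (e^~ x) t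
       - psum (p^~ x) t * psum (fun k => p k x * e k x) t) / gram_det (p^~ x) t) ^+ 2 +
    ((psum (p^~ x) t * psum (e^~ x) t
       - t%:R * psum (fun k => p k x * e k x) t) / gram_det (p^~ x) t) ^+ 2)%:E
  <= ((1 + Pb ^+ 2) / (kap ^+ 2 / 6 * t%:R `^ (1 - 2 * eta)) *
     (2 * B ^+ 2 + B ^+ 2 * (2 * ln t%:R + ln (Pb ^+ 2) - ln (kap ^+ 2 / 6))))%:E)%E.
Proof.
move=> Pb0 kap0 eta0 eta1 t2 mp me pP eB pd mart.
have D0 k x : (2 <= k)%N -> 0 < gram_det (p^~ x) k.
  move=> k2; apply: lt_le_trans (@gram_det_ge _ _ kap eta _ _ _ _ _) => //.
  rewrite mulr_gt0 ?powR_gt0 ?mulr_gt0 ?divr_gt0 ?exprn_gt0// ltr0n (ltn_trans _ k2)//.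
  by move=> k' k'1; exact: pd.
set c1 := (1 + _) / _; set A := 2 * _ + _.
pose g x := \sum_(2 <= k < t) (2 * c1) * (gram_incr (p^~ x) (e^~ x) k * e k.+1 x).
have [|gI g0] := @integrable_sum_eq0 _ _ _ P
   (fun k x => (2 * c1) * (gram_incr (p^~ x) (e^~ x) k * e k.+1 x)) 2 t.
  move=> k /andP[k2 kt].
  have [M MP] : exists M : R, forall x, `|gram_incr (p^~ x) (e^~ x) k| <= M.
    have d00 : 0 < kap ^+ 2 / 6 * k.+1%:R * k.+1%:R `^ (1 - 2 * eta) :> R.
      by rewrite !mulr_gt0 ?powR_gt0 ?exprn_gt0.
    have [M MP] := @gram_incr_bounded _ Pb B _ k d00; exists M => x.
    apply: MP => [l l1|l l1|]; [exact: pP|exact: eB|].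
    by apply: gram_det_ge => //; [exact: leqW|move=> l l1; exact: pd].
  have mL : measurable_fun setT (fun x => gram_incr (p^~ x) (e^~ x) k).
    apply: measurable_gram_incr => [l /andP[l1 _]|l /andP[l1 _]|x].
    - exact: mp.
    - exact: me.
    - by apply: D0; exact: leqW.
  have iL : P.-integrable setT
      (EFin \o (fun x => gram_incr (p^~ x) (e^~ x) k * e k.+1 x)).
    apply: (@bounded_integrable _ _ _ _ _ (M * B)).
      by apply: measurable_funM => //; exact: me.
    by move=> x; rewrite normrM ler_pM ?eB.
  split; first exact: (integrableZl measurableT (2 * c1) iL).
  under eq_integral do rewrite EFinM.
  by rewrite (integralZl measurableT iL (2 * c1)) mart// mule0.
have [m1 m2] : measurable_fun setT (fun x =>
    (psum (fun k => p k x ^+ 2) t * psum (e^~ x) t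
     - psum (p^~ x) t * psum (fun k => p k x * e k x) t) / gram_det (p^~ x) t) /\
  measurable_fun setT (fun x =>
    (psum (p^~ x) t * psum (e^~ x) t
     - t%:R * psum (fun k => p k x * e k x) t) / gram_det (p^~ x) t).
  apply: measurable_lsq => [l /andP[l1 _]|l /andP[l1 _]|x].
  - exact: mp.
  - exact: me.
  - exact: D0.
apply: (@le_trans _ _ (\int[P]_x (c1 * A + g x)%:E)%E).
  apply: ge0_le_integral => //.
  - by move=> x _; rewrite lee_fin addr_ge0// sqr_ge0.
  - by apply/measurable_EFinP; apply: measurable_funD; exact: measurable_funX.
  - apply/measurable_EFinP; apply: measurable_funD; first exact: measurable_cst.
    by apply/measurable_EFinP; case/integrableP: gI.
  - move=> x _; rewrite lee_fin; apply: lsq_error_pathwise => // k k1.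
    + exact: pP.
    + exact: eB.
    + exact: pd.
under eq_integral do rewrite EFinD.
rewrite integralD//=; last exact: finite_measure_integrable_cst.
rewrite g0 adde0 integral_cst//= -[X in (_ * X)%E]/(P setT) probability_setT mule1.
exact: lexx.
Qed.

(* Only the estimates at times [0, 2, 4, ...] enter the policy; at time [1] the
   least-squares problem has many solutions, and [ahat 1] is uncontrolled. *)
Lemma policy_measurable (R : realType) (N : nat) (d : measure_display)
    (T : measurableType d) (D : nat) (alpha beta : 'I_N -> 'I_N -> R)
    (amin amax bmin bmax rho eta : R)
    (popt : ('I_N -> 'I_N -> R) -> ('I_N -> 'I_N -> R) -> 'I_N -> 'I_N -> R)
    (price ahat bhat : nat -> 'I_N -> 'I_N -> T -> R)
    (eps : 'I_N -> 'I_N -> nat -> T -> R) :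
  0 < bmin ->
  (forall i j, i != j -> measurable_fun setT (ahat 0%N i j) /\
                         measurable_fun setT (bhat 0%N i j)) ->
  (forall i j, i != j -> forall k, (1 <= k < D)%N -> measurable_fun setT (eps i j k)) ->
  (forall t i j, i != j -> forall x,
     amin <= ahat t i j x <= amax /\ bmin <= bhat t i j x <= bmax) ->
  (forall t i j, (2 <= t)%N -> i != j -> forall x,
     0 < gram_det (fun k => price k i j x) t) ->
  (forall t i j, (2 <= t)%N -> i != j -> forall x,
     let q := psum (fun k => price k i j x ^+ 2) t in
     let s := psum (fun k => price k i j x) t in
     let g := psum (fun k => eps i j k x) t in
     let h := psum (fun k => price k i j x * eps i j k x) t in
     let D := gram_det (fun k => price k i j x) t in
     ahat t i j x = clamp amin amax ((q * g - s * h) / D + alpha i j) /\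
     bhat t i j x = clamp bmin bmax ((s * g - t%:R * h) / D + beta i j)) ->
  (forall a b : T -> 'I_N -> 'I_N -> R,
    (forall i j, i != j -> measurable_fun setT (fun x => a x i j) /\
                           measurable_fun setT (fun x => b x i j)) ->
    (forall x i j, i != j -> amin <= a x i j <= amax /\ bmin <= b x i j <= bmax) ->
    forall i j, i != j -> measurable_fun setT (fun x => popt (a x) (b x) i j)) ->
  (forall k, odd k -> forall i j, i != j -> forall x,
     price k i j x = popt (fun i j => ahat k.-1 i j x) (fun i j => bhat k.-1 i j x) i j) ->
  (forall k, (2 <= k)%N -> ~~ odd k -> forall i j, i != j -> forall x,
     price k i j x =
       popt (fun i j => ahat (k - 2)%N i j x) (fun i j => bhat (k - 2)%N i j x) i j
       - rho / bhat (k - 2)%N i j x * (k%:R `^ (- eta))) ->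
  forall k, (1 <= k <= D)%N -> forall i j, i != j -> measurable_fun setT (price k i j).
Proof.
move=> bmin0 minit meps box gram est mpopt podd peven k.
elim/ltn_ind: k => k IH /andP[k1 kD] i j ij.
have mhat t : (t = 0%N \/ (2 <= t)%N) -> (t < k)%N -> forall i j, i != j ->
    measurable_fun setT (ahat t i j) /\ measurable_fun setT (bhat t i j).
  move=> [->|t2] tk i' j' ij'; first exact: minit.
  have [m1 m2] := @measurable_lsq _ _ _ (fun k => price k i' j') (eps i' j') t
    (fun l h => IH l (leq_ltn_trans (proj2 (andP h)) tk)
       (introT andP (conj (proj1 (andP h)) (leq_trans (proj2 (andP h)) (ltnW (leq_trans tk kD)))))
       _ _ ij')
    (fun l h => meps _ _ ij' l
       (introT andP (conj (proj1 (andP h)) (leq_ltn_trans (proj2 (andP h)) (leq_trans tk kD)))))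
    (gram t i' j' t2 ij').
  split.
    rewrite (_ : ahat t i' j' = (fun x => ahat t i' j' x)); last exact/funext.
    under eq_fun do rewrite (est t i' j' t2 ij' _).1.
    by apply: measurable_clamp; apply: measurable_funD => //; exact: measurable_cst.
  rewrite (_ : bhat t i' j' = (fun x => bhat t i' j' x)); last exact/funext.
  under eq_fun do rewrite (est t i' j' t2 ij' _).2.
  by apply: measurable_clamp; apply: measurable_funD => //; exact: measurable_cst.
rewrite (_ : price k i j = (fun x => price k i j x)); last exact/funext.
have [ok|ek] := boolP (odd k).
  under eq_fun do rewrite (podd k ok i j ij).
  apply: (mpopt (fun x i j => ahat k.-1 i j x) (fun x i j => bhat k.-1 i j x)) => //.
    apply: mhat; last by rewrite prednK.
    by case: k ok {IH k1 kD} => // -[|[|k]]; [left|right|right].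
  by move=> x *; exact: box.
have k2 : (2 <= k)%N by case: k ek k1 {IH kD mhat} => // -[].
have tk : (k - 2 < k)%N by rewrite ltn_subrL.
have mh : forall i j, i != j ->
    measurable_fun setT (ahat (k - 2)%N i j) /\ measurable_fun setT (bhat (k - 2)%N i j).
  apply: mhat => //.
  (* Only [k = 3] would lead to the uncontrolled time 1, and 3 is odd. *)
  have [k3|k3|k3] := ltngtP k 3.
  - by left; apply/eqP; rewrite subn_eq0 -ltnS.
  - by right; rewrite ltn_subRL.
  - by rewrite k3 in ek.
under eq_fun do rewrite (peven k k2 ek i j ij).
apply: measurable_funB.
  apply: (mpopt (fun x i j => ahat (k - 2)%N i j x) (fun x i j => bhat (k - 2)%N i j x)) => //.
  by move=> x *; exact: box.
apply: measurable_funM; last exact: measurable_cst.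
apply: measurable_funM; first exact: measurable_cst.
apply: measurable_pos_inv; first exact: (mh i j ij).2.
by move=> x; have [_ /andP[h _]] := box (k - 2)%N i j ij x; exact: lt_le_trans h.
Qed.

(** * The rate and its constant *)

Lemma powR_neg_cvg0 (R : realType) (b : R) : 0 < b ->
  (fun n : nat => (n.-1)%:R `^ (- b) : R) @ \oo --> (0 : R).
Proof.
move=> b0; apply/cvgrPdist_le => e e0.
have [M _ MP] : exists2 M : nat, True & e^-1 `^ b^-1 <= M%:R.
  exists (Num.truncn (e^-1 `^ b^-1)).+1 => //.
  exact/ltW/truncnS_gt.
exists M.+2 => // n /= nM.
have M0 : (M < n.-1)%N by case: n nM.
rewrite sub0r normrN ger0_norm ?powR_ge0// powRN -[leRHS]invrK.
rewrite lef_pV2 ?posrE ?invr_gt0 ?powR_gt0 ?ltr0n ?(leq_ltn_trans _ M0)//.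
have -> : e^-1 = (e^-1 `^ b^-1) `^ b.
  by rewrite -powRrM mulVf ?gt_eqF// powRr1// invr_ge0 ltW.
rewrite ge0_ler_powR ?nnegrE ?powR_ge0 ?(ltW b0)//.
by rewrite (le_trans MP)// ler_nat ltnW.
Qed.

(** Half of the exponent is spent on the logarithm, through [ln y <= y - 1] at [y = x^(a / 2)]. *)
Lemma ln_le_powR (R : realType) (a x : R) : 0 < a -> 1 <= x ->
  ln x / x `^ a <= 2 / a * x `^ (- (a / 2)).
Proof.
move=> a0 x1; have x0 : 0 < x := lt_le_trans ltr01 x1.
have p0 : 0 < x `^ (a / 2) by rewrite powR_gt0.
have -> : x `^ a = x `^ (a / 2) * x `^ (a / 2).
  by rewrite -powRD ?(gt_eqF x0) ?implybT//; congr (_ `^ _); field.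
rewrite powRN ler_pdivrMr ?mulr_gt0//.
have -> : 2 / a * (x `^ (a / 2))^-1 * (x `^ (a / 2) * x `^ (a / 2)) = 2 / a * x `^ (a / 2).
  by field; rewrite !gt_eqF.
rewrite -ler_pdivrMl ?divr_gt0// invf_div -ln_powR.
have := @le_ln1Dx R (x `^ (a / 2) - 1).
rewrite addrCA subrr addr0 ltrBrDr addrC subrr => /(_ p0); lra.
Qed.

(** Dividing by [ln 4] absorbs the terms without [ln t] into a multiple of [ln t] for [t >= 4], that
    is for [d >= 5] with [t = d - 1]. The absolute values are there because the two logarithms may
    have either sign. The final [+ 1] gives strictness and positivity even for [B = 0]. *)
Definition mse_const {R : realType} (Pb B cc : R) : R :=
  (1 + Pb ^+ 2) / cc *
  ((2 * B ^+ 2 + B ^+ 2 * (`|ln (Pb ^+ 2)| + `|ln cc|)) / ln 4%:R + 2 * B ^+ 2) + 1.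

Lemma mse_const_gt (R : realType) (Pb B cc a : R) (t : nat) :
  0 < Pb -> 0 < cc -> (4 <= t)%N ->
  (1 + Pb ^+ 2) / (cc * t%:R `^ a) *
     (2 * B ^+ 2 + B ^+ 2 * (2 * ln t%:R + ln (Pb ^+ 2) - ln cc))
  < mse_const Pb B cc * ln t%:R / t%:R `^ a.
Proof.
move=> Pb0 cc0 t4.
have t0 : 0 < t%:R :> R by rewrite ltr0n (leq_trans _ t4).
have l4 : 0 < ln 4%:R :> R by rewrite ln_gt0// ltr1n.
have lt : ln 4%:R <= ln t%:R :> R by rewrite ler_ln ?posrE// ler_nat.
have lt0 := lt_le_trans l4 lt.
have p0 : 0 < t%:R `^ a by rewrite powR_gt0.
set z := t%:R `^ a in p0 *; set l := ln t%:R in lt lt0 *.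
rewrite /mse_const ltr_pdivlMr//.
set K := 2 * B ^+ 2 + B ^+ 2 * (`|_| + _).
have -> : (1 + Pb ^+ 2) / (cc * z) *
   (2 * B ^+ 2 + B ^+ 2 * (2 * l + ln (Pb ^+ 2) - ln cc)) * z
   = (1 + Pb ^+ 2) / cc * (2 * B ^+ 2 + B ^+ 2 * (2 * l + ln (Pb ^+ 2) - ln cc)).
  by field; rewrite !gt_eqF.
have c0 : 0 < (1 + Pb ^+ 2) / cc by rewrite divr_gt0// ltr_wpDr// sqr_ge0.
have B0 := sqr_ge0 B.
have K0 : 0 <= K.
  by apply: addr_ge0; [exact: mulr_ge0|apply: mulr_ge0 => //; exact: addr_ge0].
have h1 : 2 * B ^+ 2 + B ^+ 2 * (2 * l + ln (Pb ^+ 2) - ln cc) <= (K / ln 4%:R + 2 * B ^+ 2) * l.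
  have : K <= K / ln 4%:R * l by rewrite mulrAC ler_pdivlMr// ler_wpM2l.
  have : B ^+ 2 * (ln (Pb ^+ 2) - ln cc) <= B ^+ 2 * (`|ln (Pb ^+ 2)| + `|ln cc|).
    rewrite ler_wpM2l// lerD ?ler_norm//.
    by rewrite -normrN ler_norm.
  rewrite /K; lra.
have : (1 + Pb ^+ 2) / cc * (2 * B ^+ 2 + B ^+ 2 * (2 * l + ln (Pb ^+ 2) - ln cc)) <=
   (1 + Pb ^+ 2) / cc * ((K / ln 4%:R + 2 * B ^+ 2) * l) by rewrite ler_wpM2l// ltW.
lra.
Qed.

Lemma mse_const_gt0 (R : realType) (Pb B cc : R) : 0 < cc -> 0 < mse_const Pb B cc.
Proof.
move=> cc0; have l4 : 0 < ln 4%:R :> R by rewrite ln_gt0// ltr1n.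
have B0 := sqr_ge0 B.
rewrite ltr_wpDl//; apply: mulr_ge0.
  by apply: divr_ge0; [rewrite addr_ge0// sqr_ge0|exact: ltW].
apply: addr_ge0; last exact: mulr_ge0.
apply: divr_ge0; last exact: ltW.
by apply: addr_ge0; [exact: mulr_ge0|apply: mulr_ge0 => //; exact: addr_ge0].
Qed.

(** * Application to the model *)

Lemma past_indep (R : realType) (N : nat) (dm : measure_display)
    (Omega : measurableType dm) (P : probability Omega R)
    (eps : 'I_N -> 'I_N -> nat -> Omega -> R) (a0 b0 : 'I_N -> 'I_N -> Omega -> R)
    (i j : 'I_N) (d : nat) (E : set Omega) (C : set R) :
  shock_indep_past P a0 b0 eps -> i != j -> (1 <= d)%N ->
  past_events a0 b0 eps d E -> measurable C ->
  P (E `&` eps i j d @^-1` C) = (P E * P (eps i j d @^-1` C))%E.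
Proof.
move=> ind ij d1 pE mC.
(* The hypothesis treats all links of a day jointly; [setT] on the other links isolates a single
   shock. *)
pose Bc k l : set R := if (k == i) && (l == j) then C else setT.
have mB k l : measurable (Bc k l) by rewrite /Bc; case: ifP.
have := ind d d1 Bc mB E pE => /=.
set S := \bigcap_(k in _) _.
have -> : S = eps i j d @^-1` C.
  apply/seteqP; split=> [x Sx|x Cx].
    by have := Sx (i, j) ij; rewrite /Bc/= !eqxx.
  by move=> [k l] _ /=; rewrite /Bc; case: ifP => // /andP[/eqP -> /eqP ->].
by [].
Qed.

(** The residuals at [(a, b)] are those of regressing the shocks at [(a - alpha, b - beta)], so the
    estimation error is itself a least-squares solution, with the shocks as responses. *)
Lemma lsq_obj_min (R : realType) (N : nat) (dm : measure_display)
    (Omega : measurableType dm) (alpha beta : 'I_N -> 'I_N -> R)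
    (price : nat -> 'I_N -> 'I_N -> Omega -> R)
    (eps : 'I_N -> 'I_N -> nat -> Omega -> R) (t : nat) (i j : 'I_N) (x : Omega)
    (at_ bt : R) :
  0 < gram_det (fun k => price k i j x) t ->
  (forall a b, lsq_obj alpha beta price eps t i j x at_ bt
            <= lsq_obj alpha beta price eps t i j x a b) ->
  let q := psum (fun k => price k i j x ^+ 2) t in
  let s := psum (fun k => price k i j x) t in
  let g := psum (fun k => eps i j k x) t in
  let h := psum (fun k => price k i j x * eps i j k x) t in
  let D := gram_det (fun k => price k i j x) t in
  at_ = (q * g - s * h) / D + alpha i j /\
  bt = (s * g - t%:R * h) / D + beta i j.
Proof.
move=> D0 opt /=.
have obj a b : lsq_obj alpha beta price eps t i j x a b =
  psum (fun k => (eps i j k x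
        - ((a - alpha i j) - (b - beta i j) * price k i j x)) ^+ 2) t.
  by apply: eq_bigr => k _; congr (_ ^+ 2); rewrite /demand; ring.
have [|e1 e2] := @lsq_normal _ (fun k => price k i j x) (fun k => eps i j k x)
   (at_ - alpha i j) (bt - beta i j) t (lt0r_neq0 D0).
  move=> a b; have := opt (a + alpha i j) (b + beta i j).
  by rewrite !obj !addrK.
by rewrite -e1 -e2 !subrK.
Qed.

Lemma even_price_gap (R : realType) (bmax rho bh x : R) : 0 < bh -> bh <= bmax ->
  0 < rho -> 0 <= x -> rho / bmax * x <= rho / bh * x.
Proof.
move=> b0 bM r0 x0; rewrite ler_wpM2r// ler_pM2l// lef_pV2 ?posrE//.
exact: lt_le_trans bM.
Qed.

Lemma nat_powR_le1 (R : realType) (k : nat) (eta : R) : (1 <= k)%N -> 0 < eta ->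
  0 <= k%:R `^ (- eta) <= (1 : R).
Proof.
move=> k1 e0; rewrite powR_ge0/= -[leRHS](powRr0 k%:R) ler_powR ?ler1n//.
by rewrite oppr_le0 ltW.
Qed.

Lemma opt_price_bound (R : realType) (amax bmin W a b w : R) :
  0 < bmin -> 0 <= a <= amax -> bmin <= b -> 0 <= w <= W ->
  `|(a - w) / b| <= (amax + W) / bmin.
Proof.
move=> bm0 /andP[a0 aM] bb /andP[w0 wW]; have b0 := lt_le_trans bm0 bb.
rewrite normrM normfV (gtr0_norm b0) ler_pM ?invr_ge0 ?(ltW b0)//.
  by rewrite ler_norml; apply/andP; split; lra.
by rewrite lef_pV2 ?posrE.
Qed.

Lemma abs_le_bounds (R : realType) (lo hi x : R) : lo <= x <= hi -> `|x| <= `|lo| + `|hi|.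
Proof.
move=> /andP[h1 h2]; rewrite ler_norml.
have := ler_norm hi; have := ler_norm (- lo); rewrite normrN.
have := normr_ge0 hi; have := normr_ge0 lo.
by move=> *; apply/andP; split; lra.
Qed.

Lemma one_sub_double_gt0 (R : realType) (eta : R) : eta < 1 / 2 -> 0 < 1 - 2 * eta.
Proof. lra. Qed.

Lemma price_shift_le (R : realType) (bmin rho bh eta : R) (k : nat) :
  0 < bmin -> bmin <= bh -> 0 < rho -> 0 < eta -> (1 <= k)%N ->
  `|rho / bh * k%:R `^ (- eta)| <= rho / bmin.
Proof.
move=> b0 bb r0 e0 k1; have bh0 := lt_le_trans b0 bb.
have /andP[p0 p1] := nat_powR_le1 R k eta k1 e0.
rewrite ger0_norm ?mulr_ge0 ?invr_ge0 ?(ltW r0) ?(ltW bh0)//.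
apply: (@le_trans _ _ (rho / bh)).
  by rewrite ler_piMr// mulr_ge0 ?invr_ge0 ?(ltW r0) ?(ltW bh0).
by rewrite ler_pM2l// lef_pV2 ?posrE.
Qed.

Theorem theorem1
  (R : realType) (N : nat)
  (dm : measure_display) (Omega : measurableType dm) (P : probability Omega R)
  (alpha beta xi : 'I_N -> 'I_N -> R)
  (amin amax bmin bmax pmax c elo ehi : R)
  (F : 'I_N -> 'I_N -> R -> R)
  (eps : 'I_N -> 'I_N -> nat -> Omega -> R)
  (a0 b0 : 'I_N -> 'I_N -> Omega -> R)
  (popt wopt : ('I_N -> 'I_N -> R) -> ('I_N -> 'I_N -> R) -> 'I_N -> 'I_N -> R)
  (* parameter bounds and true parameters *)
  (Hamin : 0 < amin) (Hab : amin <= amax) (Hbmin : 0 < bmin) (Hbb : bmin <= bmax)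
  (Htheta : forall i j : 'I_N, i != j ->
     amin <= alpha i j <= amax /\ bmin <= beta i j <= bmax)
  (Hxi : forall i j : 'I_N, i != j -> 0 < xi i j)
  (Hc : 0 < c) (Hcp : c < pmax)
  (Hnonneg : 0 <= amin - bmax * pmax + elo)
  (* demand shocks: bounded, mean zero, law F_ij on every day *)
  (Heps : forall i j : 'I_N, i != j -> forall d : nat, (1 <= d)%N ->
     [/\ measurable_fun setT (eps i j d),
         (forall om, elo <= eps i j d om <= ehi),
         (forall x : R, P [set om | eps i j d om <= x] = (F i j x)%:E)
       & ('E_P[eps i j d] = 0)%E])
  (* day-d shocks independent of the initial draw and earlier shocks *)
  (Hindep : shock_indep_past P a0 b0 eps)
  (* initial estimate drawn (arbitrary distribution) in the box *)
  (Hinit : forall i j : 'I_N, i != j ->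
     [/\ measurable_fun setT (a0 i j), measurable_fun setT (b0 i j)
       & forall om, amin <= a0 i j om <= amax /\ bmin <= b0 i j om <= bmax])
  (* (popt, wopt) is an optimal solution of the estimated problem *)
  (Hopt : forall ah bh : 'I_N -> 'I_N -> R,
     (forall i j : 'I_N, i != j ->
        amin <= ah i j <= amax /\ bmin <= bh i j <= bmax) ->
     is_optimal P eps xi c pmax ah bh (popt ah bh) (wopt ah bh)) :
  exists Phi1 : R -> R -> R,
  forall rho eta : R, 0 < rho -> 0 < eta -> eta < 1 / 2 ->
  0 < Phi1 rho eta /\
  forall (price supply atil btil ahat bhat : nat -> 'I_N -> 'I_N -> Omega -> R),
  (* initialization *)
  (forall i j : 'I_N, i != j -> ahat 0%N i j = a0 i j /\ bhat 0%N i j = b0 i j) ->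
  (* least-squares estimate and its projection onto the box *)
  (forall t : nat, (1 <= t)%N -> forall i j : 'I_N, i != j -> forall om (a b : R),
     lsq_obj alpha beta price eps t i j om (atil t i j om) (btil t i j om)
       <= lsq_obj alpha beta price eps t i j om a b) ->
  (forall t : nat, (1 <= t)%N -> forall i j : 'I_N, i != j -> forall om,
     ahat t i j om = clamp amin amax (atil t i j om) /\
     bhat t i j om = clamp bmin bmax (btil t i j om)) ->
  (* NRPS, odd days *)
  (forall d : nat, odd d -> forall i j : 'I_N, i != j -> forall om,
     price d i j om = popt (fun k l => ahat d.-1 k l om) (fun k l => bhat d.-1 k l om) i j /\
     supply d i j om = wopt (fun k l => ahat d.-1 k l om) (fun k l => bhat d.-1 k l om) i j) ->
  (* NRPS, even days *)
  (forall d : nat, (2 <= d)%N -> ~~ odd d -> forall i j : 'I_N, i != j -> forall om,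
     price d i j om =
       popt (fun k l => ahat (d - 2)%N k l om) (fun k l => bhat (d - 2)%N k l om) i j
       - rho / bhat (d - 2)%N i j om * (d%:R `^ (- eta)) /\
     supply d i j om =
       wopt (fun k l => ahat (d - 2)%N k l om) (fun k l => bhat (d - 2)%N k l om) i j
       + rho * (d%:R `^ (- eta))) ->
  (* the policy is measurable *)
  (forall d : nat, (1 <= d)%N -> forall i j : 'I_N, i != j ->
     measurable_fun setT (price d i j)) ->
  (forall d : nat, (5 <= d)%N -> forall i j : 'I_N, i != j ->
     ('E_P[(fun om => (ahat d.-1 i j om - alpha i j) ^+ 2
                    + (bhat d.-1 i j om - beta i j) ^+ 2)%R]
      < (Phi1 rho eta * ln (d.-1)%:R / ((d.-1)%:R `^ (1 - 2 * eta)))%:E)%E) /\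
  (forall i j : 'I_N, i != j ->
     (fun d : nat => ('E_P[(fun om => (ahat d.-1 i j om - alpha i j) ^+ 2
                    + (bhat d.-1 i j om - beta i j) ^+ 2)%R])%E) @ \oo --> 0%E).
Proof.
have bmax0 : 0 < bmax := lt_le_trans Hbmin Hbb.
have amax0 : 0 < amax := lt_le_trans Hamin Hab.
have pmax0 : 0 < pmax := lt_trans Hc Hcp.
pose B := `|elo| + `|ehi|.
have B0 : 0 <= B by rewrite addr_ge0.
have epsB i j : i != j -> forall d, (1 <= d)%N -> forall x, `|eps i j d x| <= B.
  by move=> ij d d1 x; have [_ /(_ x) h _ _] := Heps i j ij d d1; exact: abs_le_bounds.
have meps i j : i != j -> forall d, (1 <= d)%N -> measurable_fun setT (eps i j d).
  by move=> ij d d1; have [] := Heps i j ij d d1.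
pose mu i j := mean_shortfall P (eps i j 1%N).
have sopt ah bh : (forall i j, i != j -> amin <= ah i j <= amax /\ bmin <= bh i j <= bmax) ->
    supply_opt xi mu c pmax ah bh (wopt ah bh) /\
    forall i j, i != j -> popt ah bh i j = (ah i j - wopt ah bh i j) / bh i j.
  move=> box; apply: (@is_optimal_supply _ _ _ _ P eps B).
  - by move=> i j ij; split; [exact: meps|exact: epsB].
  - by move=> i j ij; have [_ /andP[h _]] := box _ _ ij; exact: lt_le_trans h.
  - exact: Hopt.
have [W W0 WP] := @supply_opt_bounded _ _ xi mu _ _ _ _ _ _ Hamin Hab Hbmin Hbb Hc pmax0 Hxi.
have [C C0 CP] := @supply_opt_holder _ _ xi mu _ _ _ _ _ _ Hamin Hab Hbmin Hbb Hc pmax0 Hxi.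
(* Bounds [|(ah - w) / bh|] over the box of estimates and all optimal supplies. *)
pose P0 := (amax + W) / bmin.
have P00 : 0 < P0 by rewrite divr_gt0// addr_gt0.
have pB ah bh : (forall i j, i != j -> amin <= ah i j <= amax /\ bmin <= bh i j <= bmax) ->
    forall i j, i != j -> `|popt ah bh i j| <= P0.
  move=> box i j ij; have [so pE] := sopt _ _ box; rewrite pE//.
  have [/andP[h1 h2] /andP[h3 _]] := box _ _ ij.
  apply: opt_price_bound => //; first by rewrite h2 andbT (le_trans (ltW Hamin)).
  by rewrite (WP _ _ _ box so) ?andbT//; have [] := so.1.2 _ _ ij.
(* Stated for an arbitrary [T], to be applied to [Omega] with the sigma-algebra of the past. *)
have mpopt d (T : measurableType d) (a b : T -> 'I_N -> 'I_N -> R) :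
    (forall i j, i != j -> measurable_fun setT (fun x => a x i j) /\
                           measurable_fun setT (fun x => b x i j)) ->
    (forall x i j, i != j -> amin <= a x i j <= amax /\ bmin <= b x i j <= bmax) ->
    forall i j, i != j -> measurable_fun setT (fun x => popt (a x) (b x) i j).
  move=> mab box i j ij.
  under eq_fun do rewrite (sopt _ _ (box _)).2//.
  apply: measurable_funM; last first.
    apply: measurable_pos_inv; first exact: (mab i j ij).2.
    by move=> x; have [_ /andP[h _]] := box x i j ij; exact: lt_le_trans h.
  apply: measurable_funB; first exact: (mab i j ij).1.
  apply: (@measurable_holder_comp _ _ _ _ amin amax bmin bmax C (fun a b => wopt a b i j)) => //.
  move=> ah bh ah' bh' r bx bx' r01 hr.
  exact: CP r01 hr (sopt _ _ bx).1 (sopt _ _ bx').1 i j ij.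
(* The even-day shift adds at most [rho / bmin] to the price bound and opens a gap of at least
   [rho / bmax] times the power of the day; [eta] enters only through the exponent of the rate. *)
exists (fun rho eta => mse_const (P0 + rho / bmin) B ((rho / bmax) ^+ 2 / 6)).
move=> rho eta rho0 eta0 eta1.
have kap0 : 0 < rho / bmax by rewrite divr_gt0.
have cc0 : 0 < (rho / bmax) ^+ 2 / 6 by rewrite divr_gt0// exprn_gt0.
split; first exact: mse_const_gt0.
move=> price supply atil btil ahat bhat init lsq proj podd peven mprice.
have Pb0 : 0 < P0 + rho / bmin by rewrite addr_gt0// divr_gt0.
have box t i j : i != j -> forall x,
    amin <= ahat t i j x <= amax /\ bmin <= bhat t i j x <= bmax.
  move=> ij x; case: t => [|t].
    by have [-> ->] := init i j ij; have [_ _] := Hinit i j ij.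
  by have [-> ->] := proj t.+1 erefl i j ij x; rewrite !clamp_in.
have boxx t x : forall i j, i != j ->
    amin <= ahat t i j x <= amax /\ bmin <= bhat t i j x <= bmax.
  by move=> i j ij; exact: box.
have pbnd k i j : (1 <= k)%N -> i != j -> forall x, `|price k i j x| <= P0 + rho / bmin.
  move=> k1 ij x; have [ok|ek] := boolP (odd k).
    rewrite (podd k ok i j ij x).1 (le_trans (pB _ _ (boxx k.-1 x) i j ij))//.
    by rewrite lerDl divr_ge0 ?(ltW rho0) ?(ltW Hbmin).
  have k2 : (2 <= k)%N by case: k ek k1 => // -[].
  rewrite (peven k k2 ek i j ij x).1 (le_trans (ler_normB _ _))// lerD//.
    exact: (pB _ _ (boxx (k - 2)%N x) i j ij).
  have [_ /andP[hb _]] := box (k - 2)%N i j ij x.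
  exact: price_shift_le.
(* The two days of a pair use the same estimate, so the optimal prices cancel and exactly the
   even-day shift remains. *)
have gap i j : i != j -> forall k, (1 <= k)%N -> forall x,
    rho / bmax * k.*2%:R `^ (- eta) <= price k.*2.-1 i j x - price k.*2 i j x.
  move=> ij [//|k] _ x.
  have -> : k.+1.*2.-1 = k.*2.+1 by [].
  have o1 : odd k.*2.+1 by rewrite /= odd_double.
  have e2 : ~~ odd k.+1.*2 by rewrite odd_double.
  rewrite (podd _ o1 i j ij x).1 (peven _ _ e2 i j ij x).1 ?doubleS//.
  rewrite subSS subSS subn0 /= opprB addrCA subrr addr0.
  have [_ /andP[hb hb']] := box k.*2 i j ij x.
  by apply: even_price_gap => //; exact: lt_le_trans hb.
have gram t i j : (2 <= t)%N -> i != j -> forall x,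
    0 < gram_det (fun k => price k i j x) t.
  move=> t2 ij x; apply: lt_le_trans (@gram_det_ge _ _ (rho / bmax) eta _ _ _ t2 _) => //.
    by rewrite !mulr_gt0 ?powR_gt0 ?ltr0n ?(ltn_trans _ t2)// invr_gt0.
  by move=> k k1; exact: gap.
have est t i j : (2 <= t)%N -> i != j -> forall x,
     let q := psum (fun k => price k i j x ^+ 2) t in
     let s := psum (fun k => price k i j x) t in
     let g := psum (fun k => eps i j k x) t in
     let h := psum (fun k => price k i j x * eps i j k x) t in
     let D := gram_det (fun k => price k i j x) t in
     ahat t i j x = clamp amin amax ((q * g - s * h) / D + alpha i j) /\
     bhat t i j x = clamp bmin bmax ((s * g - t%:R * h) / D + beta i j).
  move=> t2 ij x /=; have t1 : (1 <= t)%N := ltnW t2.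
  have [-> ->] := proj t t1 i j ij x.
  by have [<- <-] := lsq_obj_min _ _ _ _ _ _ _ _ _ _ _ _ _ _ (gram t i j t2 ij x) (lsq t t1 i j ij x).
have mart i j : i != j -> forall k, (2 <= k)%N ->
   (\int[P]_x (gram_incr (fun l => price l i j x) (fun l => eps i j l x) k
               * eps i j k.+1 x)%:E = 0)%E.
  move=> ij k k2.
  have k1 : (1 <= k)%N := ltnW k2.
  have D1 x : 0 < gram_det (fun l => price l i j x) k.+1 by apply: gram => //; exact: leqW.
  have [M MP] : exists M : R, forall x,
      `|gram_incr (fun l => price l i j x) (fun l => eps i j l x) k| <= M.
    have d00 : 0 < (rho / bmax) ^+ 2 / 6 * k.+1%:R * k.+1%:R `^ (1 - 2 * eta).
      by rewrite !mulr_gt0 ?powR_gt0// invr_gt0.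
    have [M MP] := @gram_incr_bounded _ (P0 + rho / bmin) B _ k d00; exists M => x.
    apply: MP => [l l1|l l1|]; [exact: pbnd|exact: epsB|].
    by apply: gram_det_ge => // l l1; exact: gap.
  (* The generators of [past_events] at day [k.+1]: the measurable sets of [T] are then exactly the
     events to which the independence hypothesis applies. *)
  pose G : set (set Omega) := [set E | exists (i j : 'I_N) (B : set R), i != j /\ measurable B /\
        (E = a0 i j @^-1` B \/ E = b0 i j @^-1` B \/
         exists tau, (1 <= tau < k.+1)%N /\ E = eps i j tau @^-1` B)].
  pose T := g_sigma_algebraType G.
  have mG (f : T -> R) : (forall A, measurable A -> G (f @^-1` A)) -> measurable_fun setT f.
    by move=> fG _ A mA; rewrite setTI; apply: sub_sigma_algebra; exact: fG.
  have mepsT i' j' : i' != j' -> forall l, (1 <= l < k.+1)%N ->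
      measurable_fun (setT : set T) (eps i' j' l : T -> R).
    move=> ij' l lk; apply: mG => A mA; exists i', j', A; split=> //; split=> //.
    by right; right; exists l.
  have minitT i' j' : i' != j' ->
      measurable_fun (setT : set T) (ahat 0%N i' j' : T -> R) /\
      measurable_fun (setT : set T) (bhat 0%N i' j' : T -> R).
    move=> ij'; have [-> ->] := init i' j' ij'.
    split; apply: mG => A mA; exists i', j', A; split=> //; split=> //; first by left.
    by right; left.
  have mpriceT := @policy_measurable R N _ T k.+1 alpha beta amin amax bmin bmax rho eta
    popt price ahat bhat eps Hbmin minitT mepsT box gram est (mpopt _ T)
    (fun l ol i j ij x => (podd l ol i j ij x).1)
    (fun l l2 el i j ij x => (peven l l2 el i j ij x).1).
  have mLT : measurable_fun (setT : set T)
      ((fun x => gram_incr (fun l => price l i j x) (fun l => eps i j l x) k) : T -> R).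
    apply: (@measurable_gram_incr _ _ T (fun l => price l i j) (fun l => eps i j l)) => //.
      by move=> l lk; exact: mpriceT.
    by move=> l lk; exact: mepsT.
  apply: (@integral_mul_indep _ _ _ P _ (eps i j k.+1) (`|M| + B)).
  - apply: (@measurable_gram_incr _ _ Omega (fun l => price l i j) (fun l => eps i j l)) => //.
      by move=> l /andP[l1 _]; exact: mprice.
    by move=> l /andP[l1 _]; exact: meps.
  - exact: meps.
  - by move=> x; rewrite (le_trans (MP x))// (le_trans (ler_norm _))// lerDl.
  - by move=> x; rewrite (le_trans (epsB _ _ ij k.+1 erefl x))// lerDr.
  (* Measurability on [T] is used here: the preimage of [A] is an event of the past of day
     [k.+1]. *)
  - move=> A C' mA mC'; apply: (past_indep _ _ _ _ _ _ _ _ _ _ _ _ _ Hindep ij) => //.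
    by have := mLT measurableT A mA; rewrite setTI.
  - by have [] := Heps i j ij k.+1 erefl.
have mse t i j : (4 <= t)%N -> i != j ->
   ('E_P[(fun om => (ahat t i j om - alpha i j) ^+ 2 + (bhat t i j om - beta i j) ^+ 2)%R]
    < (mse_const (P0 + rho / bmin) B ((rho / bmax) ^+ 2 / 6) * ln t%:R
       / t%:R `^ (1 - 2 * eta))%:E)%E.
  move=> t4 ij; have t2 : (2 <= t)%N := leq_trans (isT : (2 <= 4)%N) t4.
  have mp k : (1 <= k)%N -> measurable_fun setT (price k i j) by move=> k1; exact: mprice.
  have key := @lsq_mse _ _ _ P (fun k => price k i j) (eps i j) _ B (rho / bmax) eta t
    Pb0 kap0 eta0 eta1 t2 mp (meps i j ij) (fun k k1 => pbnd k i j k1 ij) (epsB i j ij)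
    (gap i j ij) (mart i j ij).
  have cmp := @mse_const_gt _ (P0 + rho / bmin) B _ (1 - 2 * eta) t Pb0 cc0 t4.
  rewrite unlock; apply: le_lt_trans (le_lt_trans key _); last by rewrite lte_fin.
  have [m1 m2] := @measurable_lsq _ _ _ (fun k => price k i j) (eps i j) t
    (fun l h => mp l (proj1 (andP h))) (fun l h => meps i j ij l (proj1 (andP h)))
    (gram t i j t2 ij).
  have [Ha Hb] := Htheta i j ij.
  apply: ge0_le_integral => //.
  - by move=> x _; rewrite lee_fin addr_ge0// sqr_ge0.
  - apply/measurable_EFinP; under eq_fun do rewrite (est t i j t2 ij _).1 (est t i j t2 ij _).2.
    apply: measurable_funD; apply: measurable_funX; apply: measurable_funB;
      try exact: measurable_cst; apply: measurable_clamp; apply: measurable_funD => //;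
      exact: measurable_cst.
  - by apply/measurable_EFinP; apply: measurable_funD; exact: measurable_funX.
  - move=> x _; rewrite lee_fin; have [-> ->] := est t i j t2 ij x.
    by rewrite lerD// (le_trans (clamp_sqr_le _ _ _ _ _ _))// addrK.
split=> [d d5 i j ij|i j ij]; first by apply: mse => //; rewrite -ltnS prednK// (leq_trans _ d5).
pose K := mse_const (P0 + rho / bmin) B ((rho / bmax) ^+ 2 / 6) * (2 / (1 - 2 * eta)).
have a0' : 0 < 1 - 2 * eta by exact: one_sub_double_gt0.
apply: (@squeeze_cvge _ _ _ _ (cst 0%E) _
   (fun d : nat => (K * d.-1%:R `^ (- ((1 - 2 * eta) / 2)))%:E)).
- exists 5%N => // d /= d5.
  have d4 : (4 <= d.-1)%N by rewrite -ltnS prednK// (leq_trans _ d5).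
  rewrite expectation_ge0/=; last by move=> x; rewrite addr_ge0// sqr_ge0.
  apply: le_trans (ltW (mse _ _ _ d4 ij)) _.
  rewrite lee_fin /K -[leLHS]mulrA -[leRHS]mulrA.
  apply: ler_wpM2l; first exact/ltW/mse_const_gt0.
  apply: ln_le_powR => //.
  by rewrite ler1n (leq_trans _ d4).
- exact: cvg_cst.
- apply: cvg_EFin; first exact: nearW.
  rewrite [X in _ --> X](_ : _ = K * 0); last by rewrite mulr0.
  by apply: cvgMr; apply: powR_neg_cvg0; rewrite divr_gt0.
Qed.
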